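(* Let $r>0$ and $h>0$. There exists $\delta=\delta(r,h)>0$ such that $E_{r,h}[\mathbf{n}]>E_{r,h}[\mathbf{e}_3]$ for all $\mathbf{n}\in\mathcal{M}'$ with $0<\|\mathbf{n}-\mathbf{e}_3\|_{L^4(\mathbb{R}^2)}\le\delta$.
   Context: Maps $\mathbf{n}=(n_1,n_2,n_3):\mathbb{R}^2\to\mathbb{S}^2\subset\mathbb{R}^3$; $\mathbf{e}_3=(0,0,1)$. $D[\mathbf{n}]=\frac12\int|\nabla\mathbf{n}|^2dx$, $H[\mathbf{n}]=\int(\mathbf{n}-\mathbf{e}_3)\cdot(\nabla\times\mathbf{n})dx$ with $\nabla\times\mathbf{n}=(\partial_2n_3,-\partial_1n_3,\partial_1n_2-\partial_2n_1)$, $V[\mathbf{n}]=\frac18\int|\mathbf{n}-\mathbf{e}_3|^4dx$, $Z[\mathbf{n}]=\int(1-n_3)dx=\frac12\int|\mathbf{n}-\mathbf{e}_3|^2dx$ (integrals over $\mathbb{R}^2$), $E_{r,h}=D+rH+V+hZ$. $\mathcal{M}'=\{\mathbf{n}:\mathbb{R}^2\to\mathbb{S}^2\mid D[\mathbf{n}]+Z[\mathbf{n}]<\infty\}$. *)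

(* Defs.v *)
From HB Require Import structures.
From mathcomp Require Import all_boot all_order all_algebra.
From mathcomp Require Import all_classical all_reals all_analysis.
Set Implicit Arguments. Unset Strict Implicit. Unset Printing Implicit Defensive.
Import Order.TTheory GRing.Theory Num.Theory.
Import numFieldNormedType.Exports.
Local Open Scope classical_set_scope.
Local Open Scope ring_scope.

Section Defs.
Variable R : realType.

Definition leb2 := (@lebesgue_measure R \x @lebesgue_measure R)%E.

Definition dir (j : 'I_2) : R * R := if val j == 0%N then (1, 0) else (0, 1).

Fixpoint iter_partial (l : seq 'I_2) (f : R * R -> R) : R * R -> R :=
  match l with
  | [::] => f
  | j :: l' => fun x => 'D_(dir j) (iter_partial l' f) x
  end.

Definition smooth (f : R * R -> R) : Prop :=
  forall l : seq 'I_2, continuous (iter_partial l f) /\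
    forall (j : 'I_2) (x : R * R), derivable (iter_partial l f) x (dir j).

Definition test_fun (phi : R * R -> R) : Prop :=
  smooth phi /\ compact (closure [set x | phi x != 0]).

Definition loc_int (f : R * R -> R) : Prop :=
  measurable_fun setT f /\
  forall K : set (R * R), compact K -> measurable K ->
    leb2.-integrable K (EFin \o f).

Definition weak_partial (j : 'I_2) (f g : R * R -> R) : Prop :=
  loc_int f /\ loc_int g /\
  forall phi, test_fun phi ->
    (\int[leb2]_x (f x * 'D_(dir j) phi x)%:E
     = - \int[leb2]_x (g x * phi x)%:E)%E.

(* Maps n = (n_0, n_1, n_2) : R^2 -> R^3 (components indexed by 'I_3,
   i.e. n_1, n_2, n_3 of the paper are n 0, n 1, n 2), with
   dn j i a weak gradient: dn j i = d_(j+1) n_(i+1). *)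
Definition i1 : 'I_3 := @Ordinal 3 0 isT.
Definition i2 : 'I_3 := @Ordinal 3 1 isT.
Definition i3 : 'I_3 := @Ordinal 3 2 isT.
Definition j1 : 'I_2 := @Ordinal 2 0 isT.
Definition j2 : 'I_2 := @Ordinal 2 1 isT.

Definition e3 : 'I_3 -> R * R -> R := fun i _ => if i == i3 then 1 else 0.

Definition weak_grad (n : 'I_3 -> R * R -> R) (dn : 'I_2 -> 'I_3 -> R * R -> R) :=
  forall j i, weak_partial j (n i) (dn j i).

Definition sphere_valued (n : 'I_3 -> R * R -> R) :=
  forall x, n i1 x ^+ 2 + n i2 x ^+ 2 + n i3 x ^+ 2 = 1.

Definition dist2_e3 (n : 'I_3 -> R * R -> R) (x : R * R) : R :=
  n i1 x ^+ 2 + n i2 x ^+ 2 + (n i3 x - 1) ^+ 2.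

Local Open Scope ereal_scope.

Definition Denergy (n : 'I_3 -> R * R -> R) (dn : 'I_2 -> 'I_3 -> R * R -> R) : \bar R :=
  (2^-1)%:E * \int[leb2]_x (\sum_(j < 2) \sum_(i < 3) (dn j i x) ^+ 2)%:E.

(* H[n] = \int (n - e3) . (curl n),
   curl n = (d_2 n_3, - d_1 n_3, d_1 n_2 - d_2 n_1) *)
Definition Henergy (n : 'I_3 -> R * R -> R) (dn : 'I_2 -> 'I_3 -> R * R -> R) : \bar R :=
  \int[leb2]_x (n i1 x * dn j2 i3 x + n i2 x * (- dn j1 i3 x)
                + (n i3 x - 1) * (dn j1 i2 x - dn j2 i1 x))%:E.

Definition Venergy (n : 'I_3 -> R * R -> R) : \bar R :=
  (8^-1)%:E * \int[leb2]_x ((dist2_e3 n x) ^+ 2)%:E.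

Definition Zenergy (n : 'I_3 -> R * R -> R) : \bar R :=
  \int[leb2]_x (1 - n i3 x)%:E.

Definition Eenergy (r h : R) (n : 'I_3 -> R * R -> R) dn : \bar R :=
  Denergy n dn + r%:E * Henergy n dn + Venergy n + h%:E * Zenergy n.

Definition L4dist_e3 (n : 'I_3 -> R * R -> R) : \bar R :=
  Lnorm leb2 4%:E (fun x => (Num.sqrt (dist2_e3 n x))%:E).

Definition in_Mprime (n : 'I_3 -> R * R -> R) dn : Prop :=
  sphere_valued n /\ weak_grad n dn /\ Denergy n dn + Zenergy n < +oo.

End Defs.

(* Main.v *)
(** Write m = n - e3. Since |n| = 1, m3 = -|m|^2/2, so an integration by parts
    turns the helicity into H = 2 \int m3 (d1 m2 - d2 m1), whence, with
    W = \int |m|^4, |r H| <= D/2 + 2 r^2 W. A Sobolev inequality gives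
    W <= 48 (D + Z)^2, and W <= delta^4 then yields W <= 8 delta^2 (D + Z), so that
    for small delta the term 2 r^2 W is absorbed by D/2 + h Z; what remains is
    E >= V = W/8 > 0.

    Both the integration by parts and the Sobolev inequality rest on one fact: a
    weakly differentiable u with weak derivative v along e satisfies
    u(x + t e) - u(x) = \int_0^t v(x + s e) ds for almost every x. This is obtained
    by testing with \int_0^t phi(x - s e) ds, for phi a smooth approximation of the
    indicator of a box. *)

(* No bound on D + Z is assumed, so the helicity must be absorbed with a small factor rather than by
   a small energy. This works because |m|^4 = 4 m3^2: the helicity pairs m3, which is quadratic in
   m, with first derivatives of m. Multiplying the Sobolev bound by W <= delta^4 gives W^2 <= 48
   delta^4 (D + Z)^2, whose square root is linear in D + Z; 8 is a convenient bound for the square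
   root of 48.

   The obstacle is regularity: m is only square-integrable with weak derivatives, so it is no test
   function itself and cannot be inserted into the weak formulation. Increments take the place of
   approximation by smooth fields. The increment of a product u w integrates to zero by translation
   invariance, and dividing by t as t tends to 0 gives integration by parts. Averaging the increment
   identity over 0 < t <= 1 gives the bound along lines behind the Sobolev inequality. *)
Require Import Defs.
From HB Require Import structures.
From mathcomp Require Import all_boot all_order all_algebra.
From mathcomp Require Import all_classical all_reals all_analysis.
From mathcomp Require Import measurable_realfun ring lra.
Set Implicit Arguments. Unset Strict Implicit. Unset Printing Implicit Defensive.
Import Order.TTheory GRing.Theory Num.Theory.
Import numFieldNormedType.Exports.
Local Open Scope classical_set_scope.
Local Open Scope ring_scope.

(** * Translation invariance *)

Section translation.
Variable R : realType.
Notation mu := (@lebesgue_measure R).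
Notation mu2 := (@lebesgue_measure R \x @lebesgue_measure R)%E.

Lemma measurable_addr (v : R) :
  measurable_fun setT ((fun x => x + v) : measurableTypeR R -> measurableTypeR R).
Proof. exact: measurable_funD. Qed.

Lemma lebesgue_measure_translate (v : R) (A : set R) : measurable A ->
  pushforward mu ((fun x => x + v) : _ -> measurableTypeR R) A = mu A.
Proof.
have mf := measurable_addr v.
pose f : {mfun measurableTypeR R >-> measurableTypeR R} :=
  HB.pack ((fun x => x + v) : measurableTypeR R -> measurableTypeR R)
    (isMeasurableFun.Build _ _ _ _ _ mf).
move=> mA; apply/esym.
apply: (@lebesgue_measure_unique _ (pushforward mu f)) => //= _ [[a b]] _ <-.
rewrite /pushforward (_ : _ @^-1` _ = `]a - v, b - v]%classic).
  by rewrite !lebesgue_measure_itv/= !lte_fin ltrD2r -!EFinB opprB addrA subrK.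
by apply/seteqP; split => x /=; rewrite !in_itv /= ltrBlDr lerBrDr.
Qed.

Lemma measurable_add2 (v : R * R) :
  measurable_fun setT ((fun x => x + v) :
    measurableTypeR R * measurableTypeR R -> measurableTypeR R * measurableTypeR R).
Proof.
apply/measurable_fun_pairP; split => /=.
  by apply: (measurable_funD measurable_fst); exact: measurable_cst.
by apply: (measurable_funD measurable_snd); exact: measurable_cst.
Qed.

Lemma leb2_translate (v : R * R) (A : set (R * R)) : measurable A ->
  pushforward mu2 ((fun x => x + v) : _ -> measurableTypeR R * measurableTypeR R) A
  = mu2 A.
Proof.
have mf := measurable_add2 v.
pose f : {mfun (measurableTypeR R * measurableTypeR R)%type >->
    (measurableTypeR R * measurableTypeR R)%type} :=
  HB.pack ((fun x => x + v) : measurableTypeR R * measurableTypeR R -> _)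
    (isMeasurableFun.Build _ _ _ _ _ mf).
move=> mA; apply/esym.
apply: (@product_measure_unique _ _ _ _ _ mu mu (pushforward mu2 f)) => // B C mB mC.
transitivity (mu2 (((fun x => x + v.1) @^-1` B) `*` ((fun x => x + v.2) @^-1` C))) => //.
rewrite product_measure1E //.
- by congr (_ * _)%E; exact: lebesgue_measure_translate.
- by rewrite -[X in measurable X]setTI; exact: (measurable_addr v.1).
- by rewrite -[X in measurable X]setTI; exact: (measurable_addr v.2).
Qed.

Lemma ge0_integral_translate1 (v : R) (f : R -> \bar R) :
  measurable_fun setT f -> (forall x, 0 <= f x)%E ->
  (\int[mu]_x f ((x : R) + v)%R = \int[mu]_x f x)%E.
Proof.
move=> mf f0.
have := @ge0_integral_pushforward _ _ _ _ R _ (measurable_addr v) mu setT f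
  measurableT mf (fun x _ => f0 x).
rewrite preimage_setT /= => <-.
apply: eq_measure_integral; first exact: measurable_addr.
by move=> ? A mA _; exact: lebesgue_measure_translate.
Qed.

Lemma ge0_integral_translate (v : R * R) (f : R * R -> \bar R) :
  measurable_fun setT f -> (forall x, 0 <= f x)%E ->
  (\int[mu2]_x f ((x : R * R) + v)%R = \int[mu2]_x f x)%E.
Proof.
move=> mf f0.
have := @ge0_integral_pushforward _ _ _ _ R _ (measurable_add2 v) mu2 setT f
  measurableT mf (fun x _ => f0 x).
rewrite preimage_setT /= => <-.
apply: eq_measure_integral; first exact: measurable_add2.
by move=> ? A mA _; exact: leb2_translate.
Qed.

Lemma measurable_translate d (T : measurableType d) (v : R * R) (f : R * R -> T) :
  measurable_fun setT f -> measurable_fun setT (fun x : R * R => f (x + v)).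
Proof. by move=> mf; exact: (measurableT_comp mf (measurable_add2 v)). Qed.

Lemma integrable_translate (v : R * R) (f : R * R -> \bar R) :
  mu2.-integrable setT f -> mu2.-integrable setT (fun x : R * R => f (x + v)).
Proof.
move=> /integrableP[mf fi]; apply/integrableP; split.
  exact: measurable_translate.
rewrite (@ge0_integral_translate v (fun x => `|f x|%E)) //.
exact: measurableT_comp.
Qed.

Lemma integral_translate (v : R * R) (f : R * R -> \bar R) :
  measurable_fun setT f ->
  (\int[mu2]_x f ((x : R * R) + v)%R = \int[mu2]_x f x)%E.
Proof.
move=> mf; rewrite integralE [RHS]integralE.
congr (_ - _)%E.
  rewrite -(@ge0_integral_translate v f^\+%E) //; last exact: measurable_funepos.
  by apply: eq_integral => x _; rewrite !funeposE.
rewrite -(@ge0_integral_translate v f^\-%E) //; last exact: measurable_funeneg.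
by apply: eq_integral => x _; rewrite !funenegE.
Qed.

End translation.

(** * Test functions *)

Section bump.
Variable R : realType.

(** The flat function e^(-1/x) is [theta 0]. The factors x^(-n) are carried along because
    differentiation sends [theta n] to a combination of [theta n.+1] and [theta n.+2]. *)
Definition theta (n : nat) (x : R) : R :=
  if 0 < x then x^-1 ^+ n * expR (- x^-1) else 0.

Lemma theta_ge0 n x : 0 <= theta n x.
Proof.
rewrite /theta; case: ifPn => // x0.
by rewrite mulr_ge0 ?expR_ge0// exprn_ge0// invr_ge0 ltW.
Qed.

(** With z = 1/x this is z^(n+2) / (n+2)! <= e^z. A quadratic bound is what differentiability at the
    origin needs. *)
Lemma theta_le n x : theta n x <= (n.+2)`!%:R * x ^+ 2.
Proof.
rewrite /theta; case: ifPn => [x0|_]; last by rewrite mulr_ge0 ?sqr_ge0.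
have z0 : 0 <= x^-1 by rewrite invr_ge0 ltW.
have := expR_ge1Dxn n.+1 z0.
have f0 : 0 < (n.+2)`!%:R :> R by rewrite ltr0n fact_gt0.
have e0 := expR_gt0 x^-1.
rewrite expRN => H; rewrite ler_pdivrMr//.
have {}H : x^-1 ^+ n.+2 <= (n.+2)`!%:R * expR x^-1.
  by rewrite mulrC -ler_pdivrMr// (le_trans _ H)// lerDr.
have -> : x^-1 ^+ n = x^-1 ^+ n.+2 * x ^+ 2.
  by rewrite !exprS expr0; field; rewrite gt_eqF.
by rewrite [leRHS]mulrAC ler_wpM2r ?sqr_ge0.
Qed.

Lemma theta_le1 x : theta 0 x <= 1.
Proof.
rewrite /theta; case: ifPn => // x0.
by rewrite expr0 mul1r expR_le1 oppr_le0 invr_ge0 ltW.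
Qed.

Lemma theta_ge x : 0 < x -> 1 - x^-1 <= theta 0 x.
Proof. by move=> x0; rewrite /theta x0 expr0 mul1r expR_ge1Dx. Qed.

Lemma is_derive_theta n (x : R) :
  is_derive x (1 : R) (theta n) (theta n.+2 x - n%:R * theta n.+1 x).
Proof.
have [x0|x0|->] := ltgtP x 0.
- have E : \forall y \near x, cst (0 : R) y = theta n y.
    near=> y; rewrite /theta ifF//; apply/negbTE; rewrite -leNgt ltW//.
    by near: y; exact: lt_nbhsl.
  rewrite /theta !ifF ?mulr0 ?subr0; [|by apply/negbTE; rewrite -leNgt ltW..].
  apply: DeriveDef.
    exact: (near_eq_derivable E).
  by rewrite -(near_eq_derive _ E) derive_cst.
- have E : \forall y \near x, (fun y : R => y^-1 ^+ n * expR (- y^-1)) y = theta n y.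
    near=> y; rewrite /theta ifT//.
    by near: y; exact: lt_nbhsr.
  have xN0 : x != 0 by rewrite gt_eqF.
  have dV : is_derive x (1:R) (fun y : R => y^-1) (- x ^- 2).
    by have := @is_deriveV R id x 1 1 xN0 (is_derive_id _ _); rewrite scaler1.
  have dn : is_derive (x^-1) (1:R) (fun y : R => y ^+ n * expR (- y))
     (n%:R * x^-1 ^+ n.-1 * expR (- x^-1) - x^-1 ^+ n * expR (- x^-1)).
    have d1 : is_derive (x^-1) (1:R) (fun y : R => y ^+ n) (n%:R * x^-1 ^+ n.-1).
      have := @is_deriveX _ _ id n x^-1 1 1 (is_derive_id _ _).
      by rewrite scaler1 (_ : id ^+ n = (fun y : R => y ^+ n))//; apply/funext => y;
        rewrite fctE.
    have d2 : is_derive (x^-1) (1:R) (fun y : R => expR (- y)) (expR (- x^-1) * -1).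
      exact: is_derive1_comp.
    by apply: is_derive_eq; rewrite /GRing.scale /=; ring.
  have d := @is_derive1_comp R (fun y : R => y ^+ n * expR (- y)) (fun y : R => y^-1)
    x _ _ dn dV.
  apply: DeriveDef.
    by apply: (near_eq_derivable E); exact: (@ex_derive _ _ _ _ _ _ _ d).
  rewrite -(near_eq_derive _ E) (@derive_val _ _ _ _ _ _ _ d) /theta x0.
  rewrite -exprVn; case: n {E dn d} => [|n] /=; first by rewrite expr0; ring.
  by rewrite !exprS; ring.
(* At the origin [theta_le] bounds the difference quotient by a multiple of |h|, so the derivative
   is 0. *)
- rewrite /theta ltxx mulr0 subr0.
  suff : h^-1 *: (theta n (h *: (1 : R) + 0) - theta n 0) @[h --> (0 : R)^'] --> (0 : R).
    move=> H; apply: DeriveDef; first by apply/cvg_ex; exists 0.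
    by apply/cvg_lim => //.
  have -> : theta n 0 = 0 by rewrite /theta ltxx.
  apply/cvgr0Pnorm_le => e e0; near=> h.
  rewrite subr0 addr0 {2}/GRing.scale /= mulr1 normrM normfV ger0_norm ?theta_ge0//.
  have h0 : h != 0 by near: h; exact: nbhs_dnbhs_neq.
  rewrite ler_pdivrMl ?normr_gt0//.
  apply: le_trans (theta_le _ _) _.
  rewrite -real_normK ?num_real// expr2 mulrCA ler_pM2l ?normr_gt0//.
  rewrite -ler_pdivlMl ?ltr0n ?fact_gt0//.
  by near: h; apply: dnbhs0_le; rewrite mulr_gt0 ?invr_gt0 ?ltr0n ?fact_gt0.
Unshelve. all: by end_near. Qed.

(** Smoothness by an invariant: [f] lies in some set of functions that is stable under
    differentiation. No iterated derivative has to be computed; only the invariant set has to be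
    exhibited. *)
Definition smooth1 (f : R -> R) : Prop :=
  exists2 S : set (R -> R), S f &
    forall g, S g -> exists2 g', S g' & forall x, is_derive x (1 : R) g (g' x).

(** The invariant set for the functions built from [theta]: by the chain and Leibniz rules the
    algebra generated by all [theta n] of affine arguments is stable under differentiation. *)
Inductive theta_alg : (R -> R) -> Prop :=
| theta_alg_theta n (a b : R) : theta_alg (fun x => theta n (a * x + b))
| theta_alg_cst (c : R) : theta_alg (fun=> c)
| theta_alg_add f g : theta_alg f -> theta_alg g -> theta_alg (fun x => f x + g x)
| theta_alg_mul f g : theta_alg f -> theta_alg g -> theta_alg (fun x => f x * g x).

Lemma theta_alg_smooth1 f : theta_alg f -> smooth1 f.
Proof.
move=> Sf; exists theta_alg => // {Sf}f.
elim => {f} [n a b|c|f g Sf [f' Sf' df] Sg [g' Sg' dg]|f g Sf [f' Sf' df] Sg [g' Sg' dg]].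
- exists (fun x => (theta n.+2 (a * x + b) + (- n%:R) * theta n.+1 (a * x + b)) * a).
    apply: theta_alg_mul; last exact: theta_alg_cst.
    apply: theta_alg_add; first exact: theta_alg_theta.
    by apply: theta_alg_mul; [exact: theta_alg_cst|exact: theta_alg_theta].
  move=> x; rewrite mulNr.
  apply: (@is_derive1_comp _ (theta n) (fun x => a * x + b)).
    exact: is_derive_theta.
  by apply: is_derive_eq; rewrite /GRing.scale /=; ring.
- by exists (fun=> 0); [exact: theta_alg_cst|move=> x; exact: is_derive_cst].
- exists (fun x => f' x + g' x); first exact: theta_alg_add.
  by move=> x; apply: is_deriveD.
- exists (fun x => f x * g' x + g x * f' x).
    by apply: theta_alg_add; apply: theta_alg_mul.
  by move=> x; have [] := (df x, dg x) => ? ?; apply: is_deriveM.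
Qed.


(** With K = k + 1, the first factor vanishes for x <= a and tends to 1 for x > a. The argument of
    the second is at least K for x <= b and is nonpositive once x >= b + 1/K. Hence the limit is the
    indicator of ]a, b], right end included, and all supports lie in [a, b + 1]. *)
Definition soft_indic (a b : R) (k : nat) (x : R) : R :=
  theta 0 (k.+1%:R * (x - a)) * theta 0 (k.+1%:R ^+ 2 * (b - x) + k.+1%:R).

Lemma smooth1_soft_indic a b k : smooth1 (soft_indic a b k).
Proof.
apply: theta_alg_smooth1; apply: theta_alg_mul.
  have := theta_alg_theta 0 k.+1%:R (- (k.+1%:R * a)).
  by under [X in theta_alg X -> _]eq_fun do rewrite -mulrBr.
have := theta_alg_theta 0 (- k.+1%:R ^+ 2) (k.+1%:R ^+ 2 * b + k.+1%:R).
congr (theta_alg _); apply/funext => x; congr (theta _ _); ring.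
Qed.

Lemma soft_indic_ge0 a b k x : 0 <= soft_indic a b k x.
Proof. by rewrite mulr_ge0 ?theta_ge0. Qed.

Lemma soft_indic_le1 a b k x : soft_indic a b k x <= 1.
Proof. by rewrite mulr_ile1 ?theta_ge0 ?theta_le1. Qed.

Lemma soft_indic_out a b k x : x \notin `[a, b + 1] -> soft_indic a b k x = 0.
Proof.
rewrite in_itv/= negb_and -!ltNge => /orP[xa|xb]; rewrite /soft_indic.
  rewrite /theta ifF ?mul0r//; apply/negbTE; rewrite -leNgt.
  by rewrite mulr_ge0_le0// subr_le0 ltW.
rewrite [X in _ * X]/theta ifF ?mulr0//; apply/negbTE; rewrite -leNgt.
have k1 : 1 <= k.+1%:R :> R by rewrite ler1n.
have -> : k.+1%:R ^+ 2 * (b - x) + k.+1%:R = k.+1%:R * (k.+1%:R * (b - x) + 1) :> R.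
  by ring.
rewrite mulr_ge0_le0//.
have : k.+1%:R * (b - x) <= k.+1%:R * -1 :> R.
  by rewrite ler_wpM2l// lerBlDr; lra.
lra.
Qed.

Lemma cvg_theta_pinfty (y : R ^nat) (c : R) : 0 < c ->
  (forall k, k.+1%:R * c <= y k) -> theta 0 (y k) @[k --> \oo] --> (1 : R).
Proof.
move=> c0 yc.
have y0 k : 0 < y k by apply: lt_le_trans (yc k); rewrite mulr_gt0.
apply: (@squeeze_cvgr _ _ _ _ (fun k => 1 - c^-1 * harmonic k) (fun=> 1)).
- near=> k; rewrite theta_le1 andbT.
  apply: le_trans (theta_ge (y0 k)); rewrite lerD2l lerN2 /harmonic -invfM.
  by rewrite lef_pV2 ?posrE// ?mulr_gt0// mulrC.
- rewrite -[X in _ --> X]subr0; apply: cvgB; first exact: cvg_cst.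
  rewrite -[X in _ --> X](mulr0 c^-1); apply: cvgMr; exact: cvg_harmonic.
- exact: cvg_cst.
Unshelve. all: by end_near. Qed.

Lemma soft_indic_cvg a b x : soft_indic a b k x @[k --> \oo] --> (\1_(`]a, b]) x : R).
Proof.
rewrite indicE; have [/set_mem/=|/negP H] := boolP (x \in (`]a, b])%classic).
  rewrite in_itv/= => /andP[ax xb].
  rewrite -[X in _ --> X]mulr1; apply: cvgM.
    by apply: (@cvg_theta_pinfty _ (x - a)); rewrite ?subr_gt0.
  apply: (@cvg_theta_pinfty _ 1) => // k.
  by rewrite mulr1 lerDr mulr_ge0// ?exprn_ge0// subr_ge0.
have [ax|ax] := leP x a.
  rewrite (_ : (fun k => _) = fun=> 0); first exact: cvg_cst.
  apply/funext => k; rewrite /soft_indic /theta ifF ?mul0r//; apply/negbTE; rewrite -leNgt.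
  by rewrite mulr_ge0_le0// subr_le0.
have bx : b < x.
  by rewrite ltNge; apply/negP => xb; apply: H; rewrite inE/= in_itv/= ax.
apply: (@cvg_near_cst _ _ _ _ _ _); near=> k.
rewrite /soft_indic [X in _ * X]/theta ifF ?mulr0//; apply/negbTE; rewrite -leNgt.
have -> : k.+1%:R ^+ 2 * (b - x) + k.+1%:R = k.+1%:R * (1 - k.+1%:R * (x - b)) :> R.
  by ring.
rewrite mulr_ge0_le0// subr_le0 -ler_pdivrMr ?subr_gt0// mul1r.
near: k; exists (Num.truncn (x - b)^-1) => // n /= Hn.
apply/ltW/(lt_le_trans (truncnS_gt _)).
by rewrite ler_nat.
Unshelve. all: by end_near. Qed.

Lemma smooth1_continuous f : smooth1 f -> continuous f.
Proof.
move=> [S Sf dS] x; have [f' _ df] := dS _ Sf.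
by apply/differentiable_continuous/derivable1_diffP; have [] := df x.
Qed.

Lemma soft_indic_integrable a b k (D : set R) : measurable D ->
  (@lebesgue_measure R).-integrable D (EFin \o soft_indic a b k).
Proof.
move=> mD.
have mb : measurable_fun setT (soft_indic a b k).
  by apply: continuous_measurable_fun; exact: smooth1_continuous (smooth1_soft_indic a b k).
apply: (@integrableS _ _ _ _ setT) => //.
have ii := integrable_indic_itv a (b + 1) true false.
apply: (le_integrable measurableT _ _ ii).
- exact/measurable_EFinP.
- move=> x _ /=; rewrite lee_fin indicE.
  case: (boolP (x \in `[a, b + 1])) => xab.
    by rewrite mem_set//= normr1 ger0_norm ?soft_indic_ge0// soft_indic_le1.
  by rewrite soft_indic_out// normr0.
Qed.

Lemma soft_indic_primitive a b k : exists A : R -> R,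
  [/\ smooth1 A, forall x, is_derive x (1 : R) A (soft_indic a b k x) &
    forall x t, 0 < t ->
    \int[@lebesgue_measure R]_(s in `[0, t]) soft_indic a b k (x - s) = A x - A (x - t)].
Proof.
have cb : continuous (soft_indic a b k) by exact: smooth1_continuous (smooth1_soft_indic a b k).
pose A (x : R) := \int[@lebesgue_measure R]_(t in `]-oo, x]) soft_indic a b k t.
have dA x : is_derive x (1 : R) A (soft_indic a b k x).
  have [] := @continuous_FTC1 R (soft_indic a b k) -oo%O x (x + 1) _ _ _ (cb x).
  - by rewrite ltrDl.
  - exact: soft_indic_integrable.
  - by rewrite ltNyr.
  - by move=> h1 h2; apply: (DeriveDef h1); rewrite -derive1E.
exists A; split => //.
- have [S Sb dS] := smooth1_soft_indic a b k.
  (* Adjoining the primitive to an invariant set of its derivative leaves the set invariant. *)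
  exists (S `|` [set A]); first by right.
  move=> g [Sg|->]; last by exists (soft_indic a b k); [left|].
  by have [g' Sg' dg] := dS _ Sg; exists g'; [left|].
- move=> x t t0.
  have dF s : is_derive s (1 : R) (fun s => - A (x - s)) (soft_indic a b k (x - s)).
    have d1 : is_derive s (1 : R) (fun s : R => x - s) (-1).
      by rewrite -[X in is_derive _ _ _ X]sub0r; exact: (is_deriveB (is_derive_cst x s 1) (is_derive_id s 1)).
    have := @is_derive1_comp R A (fun s : R => x - s) s _ _ (dA _) d1.
    by move=> d2; apply: is_derive_eq; rewrite mulrN1 opprK.
  have cF : continuous (fun s => - A (x - s)).
    by move=> s; apply/differentiable_continuous/derivable1_diffP; have [] := dF s.
  rewrite /Rintegral (@continuous_FTC2 _ (fun s => soft_indic a b k (x - s))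
    (fun s => - A (x - s)) 0 t) //=.
  + by rewrite subr0 opprK addrC.
  + apply: continuous_subspaceT => s.
    apply: (@continuous_comp _ _ _ (fun s : R => x - s) (soft_indic a b k)); last exact: cb.
    by apply: cvgB; [exact: cvg_cst|exact: cvg_id].
  + split.
    * by move=> s _; have [] := dF s.
    * exact: cvg_at_right_filter (cF 0).
    * exact: cvg_at_left_filter (cF t).
  + by move=> s _; rewrite derive1E; exact: (@derive_val _ _ _ _ _ _ _ (dF s)).
Qed.

(** * Test functions on the plane as tensor products *)

Lemma is_derive_tensor1 (f g : R -> R) (x : R * R) a :
  is_derive x.1 (1 : R) f a ->
  is_derive x ((1, 0) : R * R) (fun z => f z.1 * g z.2) (a * g x.2).
Proof.
move=> df.
suff H : h^-1 *: (f (h *: ((1, 0) : R * R) + x).1 * g (h *: ((1, 0) : R * R) + x).2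
    - f x.1 * g x.2) @[h --> (0 : R)^'] --> a * g x.2.
  apply: DeriveDef; first by apply/cvg_ex; exists (a * g x.2).
  by apply/cvg_lim.
rewrite (_ : (fun h => _) =
    fun h : R => (h^-1 *: (f (h *: (1 : R) + x.1) - f x.1)) * g x.2); last first.
  apply/funext => h /=; have -> : h *: (0 : R) + x.2 = x.2 by rewrite scaler0 add0r.
  by rewrite -mulrBl -scalerAl.
apply: cvgMl; have [+ <-] := df.
by move=> H; exact: H.
Qed.

Lemma is_derive_tensor2 (f g : R -> R) (x : R * R) a :
  is_derive x.2 (1 : R) g a ->
  is_derive x ((0, 1) : R * R) (fun z => f z.1 * g z.2) (f x.1 * a).
Proof.
move=> df.
suff H : h^-1 *: (f (h *: ((0, 1) : R * R) + x).1 * g (h *: ((0, 1) : R * R) + x).2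
    - f x.1 * g x.2) @[h --> (0 : R)^'] --> f x.1 * a.
  apply: DeriveDef; first by apply/cvg_ex; exists (f x.1 * a).
  by apply/cvg_lim.
rewrite (_ : (fun h => _) =
    fun h : R => f x.1 * (h^-1 *: (g (h *: (1 : R) + x.2) - g x.2))); last first.
  apply/funext => h /=; have -> : h *: (0 : R) + x.1 = x.1 by rewrite scaler0 add0r.
  by rewrite -mulrBr -scalerAr.
apply: cvgMr; have [+ <-] := df.
by move=> H; exact: H.
Qed.

(** A partial derivative acts on one factor only, so every iterated partial derivative is again a
    tensor product, with factors in the two invariant sets. *)
Lemma smooth_tensor (f g : R -> R) : smooth1 f -> smooth1 g ->
  smooth (fun x : R * R => f x.1 * g x.2).
Proof.
move=> [S Sf dS] [T Tg dT].
have D (j : 'I_2) f1 g1 : S f1 -> T g1 -> exists f2 g2, [/\ S f2, T g2 &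
    forall x, is_derive x (dir R j) (fun z : R * R => f1 z.1 * g1 z.2) (f2 x.1 * g2 x.2)].
  move=> Sf1 Tg1; rewrite /dir; case: ifP => _.
    have [f2 Sf2 df] := dS _ Sf1; exists f2, g1; split => // x.
    exact: is_derive_tensor1.
  have [g2 Tg2 dg] := dT _ Tg1; exists f1, g2; split => // x.
  exact: is_derive_tensor2.
have main l : exists f1 g1, [/\ S f1, T g1 &
    iter_partial l (fun x : R * R => f x.1 * g x.2) = fun x => f1 x.1 * g1 x.2].
  elim: l => [|j l [f1 [g1 [Sf1 Tg1 /= ->]]]]; first by exists f, g.
  have [f2 [g2 [Sf2 Tg2 d]]] := D j _ _ Sf1 Tg1; exists f2, g2; split => //.
  by apply/funext => x; have [_ ->] := d x.
move=> l; have [f1 [g1 [Sf1 Tg1 ->]]] := main l; split.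
  have cf : continuous f1 by apply: smooth1_continuous; exists S.
  have cg : continuous g1 by apply: smooth1_continuous; exists T.
  move=> x; apply: cvgM.
    by apply: (@continuous_comp _ _ _ fst f1); [exact: cvg_fst|exact: cf].
  by apply: (@continuous_comp _ _ _ snd g1); [exact: cvg_snd|exact: cg].
by move=> j x; have [f2 [g2 [_ _ d]]] := D j _ _ Sf1 Tg1; have [] := d x.
Qed.

Lemma test_fun_tensor (f g : R -> R) (a b c d : R) : smooth1 f -> smooth1 g ->
  (forall x, x \notin `[a, b] -> f x = 0) -> (forall x, x \notin `[c, d] -> g x = 0) ->
  test_fun (fun x : R * R => f x.1 * g x.2).
Proof.
move=> sf sg f0 g0; split; first exact: smooth_tensor.
have cK : compact (`[a, b]%classic `*` `[c, d]%classic : set (R * R)).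
  by apply: compact_setX; exact: segment_compact.
apply: (subclosed_compact _ cK); first exact: closed_closure.
have -> : `[a, b]%classic `*` `[c, d]%classic =
    closure (`[a, b]%classic `*` `[c, d]%classic : set (R * R)).
  by apply/closure_id; apply: compact_closed => //; exact: norm_hausdorff.
apply: closure_subset => -[x y] /= xy; split => /=.
  by apply: contraT => /f0 xE; move: xy; rewrite xE mul0r eqxx.
by apply: contraT => /g0 xE; move: xy; rewrite xE mulr0 eqxx.
Qed.

Definition soft_box (a b c d : R) (k : nat) (x : R * R) : R :=
  soft_indic a b k x.1 * soft_indic c d k x.2.

(* The test function whose [j]-th derivative is a difference of two translates
   of the soft_indic: it turns the weak derivative into a statement on increments. *)
Lemma soft_box_primitive (a b c d : R) (k : nat) (j : 'I_2) (t : R) : 0 < t ->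
  exists Phi : R * R -> R, [/\ test_fun Phi,
    forall x, 'D_(dir R j) Phi x = soft_box a b c d k x - soft_box a b c d k (x - t *: dir R j) &
    forall x, Phi x = \int[@lebesgue_measure R]_(s in `[0, t])
      soft_box a b c d k (x - s *: dir R j)].
Proof.
move=> t0.
have iB (p q : R) x : (@lebesgue_measure R).-integrable `[0, t]
    (EFin \o (fun s : R => soft_indic p q k (x - s))).
  have cb : continuous (fun s => soft_indic p q k (x - s)).
    move=> s; apply: (@continuous_comp _ _ _ (fun s : R => x - s) (soft_indic p q k)).
      by apply: cvgB; [exact: cvg_cst|exact: cvg_id].
    exact: (smooth1_continuous (smooth1_soft_indic p q k)).
  apply: continuous_compact_integrable; first exact: segment_compact.
  exact: continuous_subspaceT.
(* The increments of the members of an invariant set form an invariant set. *)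
have shift (A : R -> R) : smooth1 A -> smooth1 (fun x => A x - A (x - t)).
  move=> [S SA dS]; exists [set g | exists2 h, S h & g = fun x => h x - h (x - t)].
    by exists A.
  move=> _ [h Sh ->]; have [h' Sh' dh] := dS _ Sh.
  exists (fun x => h' x - h' (x - t)); first by exists h'.
  move=> x; apply: is_deriveB.
  have d1 : is_derive x (1 : R) (fun s : R => s - t) 1.
    by rewrite -[X in is_derive _ _ _ X]subr0;
      exact: (is_deriveB (is_derive_id x 1) (is_derive_cst t x 1)).
  by have := @is_derive1_comp R h (fun s : R => s - t) x _ _ (dh _) d1; rewrite mulr1.
have dshift p q A : (forall x, is_derive x (1 : R) A (soft_indic p q k x)) ->
    forall x, is_derive x (1 : R) (fun x => A x - A (x - t))
      (soft_indic p q k x - soft_indic p q k (x - t)).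
  move=> dA x; apply: is_deriveB.
  have d1 : is_derive x (1 : R) (fun s : R => s - t) 1.
    by rewrite -[X in is_derive _ _ _ X]subr0;
      exact: (is_deriveB (is_derive_id x 1) (is_derive_cst t x 1)).
  by have := @is_derive1_comp R A (fun s : R => s - t) x _ _ (dA _) d1; rewrite mulr1.
(* The primitive itself has no compact support. Its increment does, being the integral of
   [soft_indic] over the window [x - t, x]. *)
have out p q A : (forall x t, 0 < t -> \int[@lebesgue_measure R]_(s in `[0, t])
    soft_indic p q k (x - s) = A x - A (x - t)) ->
    forall x, x \notin `[p, q + 1 + t] -> A x - A (x - t) = 0.
  move=> iA x xout; rewrite -iA//.
  transitivity (\int[@lebesgue_measure R]_(s in `[0, t]) (0 : R)); last first.
    by rewrite Rintegral_cst ?mul0r.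
  apply: eq_Rintegral => s; rewrite inE/= in_itv/= => /andP[s0 st].
  apply: soft_indic_out; apply: contra xout; rewrite !in_itv/= => /andP[h1 h2].
  by apply/andP; split; lra.
case: (pselect (val j = 0%N)) => [j0|j0].
- have dirE : dir R j = (1, 0) by rewrite /dir j0.
  have [A [sA dA iA]] := soft_indic_primitive a b k.
  exists (fun x => (A x.1 - A (x.1 - t)) * soft_indic c d k x.2); split.
  + apply: (test_fun_tensor (shift _ sA) (smooth1_soft_indic c d k)).
      exact: out iA.
    exact: soft_indic_out.
  + move=> x; rewrite dirE.
    have [_ ->] := is_derive_tensor1 (soft_indic c d k) (dshift _ _ _ dA x.1).
    by rewrite /soft_box /= scaler0 subr0 -[t *: 1]/(t * 1) mulr1 mulrBl.
  + move=> x; rewrite dirE -(iA _ _ t0) -(RintegralZr _ _ (iB a b x.1)); last exact: measurable_itv.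
    by apply: eq_Rintegral => s _; rewrite /soft_box /= scaler0 subr0 -[s *: 1]/(s * 1) mulr1.
- have dirE : dir R j = (0, 1) by rewrite /dir; case: eqP.
  have [A [sA dA iA]] := soft_indic_primitive c d k.
  exists (fun x => soft_indic a b k x.1 * (A x.2 - A (x.2 - t))); split.
  + apply: (test_fun_tensor (smooth1_soft_indic a b k) (shift _ sA)).
      exact: soft_indic_out.
    exact: out iA.
  + move=> x; rewrite dirE.
    have [_ ->] := is_derive_tensor2 (soft_indic a b k) (dshift _ _ _ dA x.2).
    by rewrite /soft_box /= scaler0 subr0 -[t *: 1]/(t * 1) mulr1 mulrBr.
  + move=> x; rewrite dirE -(iA _ _ t0) -(RintegralZl _ _ (iB c d x.2)); last exact: measurable_itv.
    by apply: eq_Rintegral => s _; rewrite /soft_box /= scaler0 subr0 -[s *: 1]/(s * 1) mulr1.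
Qed.

End bump.

(** * Functions with vanishing integral on boxes *)

Section density.
Context d (T : measurableType d) (R : realType) (nu : {measure set T -> \bar R}).
Variables (f : T -> \bar R) (mf : measurable_fun setT f) (f0 : forall x, (0 <= f x)%E).

(** Packaged as a measure so that the positive and negative parts of a function can be compared
    through uniqueness of measures. *)
Definition density (A : set T) : \bar R := (\int[nu]_(x in A) f x)%E.

Let density0 : density set0 = 0%E.
Proof. exact: integral_set0. Qed.

Let density_ge0 A : (0 <= density A)%E.
Proof. exact: integral_ge0. Qed.

Let density_sigma_additive : semi_sigma_additive density.
Proof.
move=> F mF tF mUF; rewrite /density ge0_integral_bigcup//.
  by apply: is_cvg_nneseries => *; exact: integral_ge0.
by apply: measurable_funS mf.
Qed.

HB.instance Definition _ := isMeasure.Build _ _ _ density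
  density0 density_ge0 density_sigma_additive.

Definition density_measure : {measure set T -> \bar R} := density.

End density.

Section boxes.
Variable R : realType.
Notation mu := (@lebesgue_measure R).
Notation mu2 := (@lebesgue_measure R \x @lebesgue_measure R)%E.

Notation R2 := (measurableTypeR R * measurableTypeR R)%type.

Definition box (a b c d : R) : set R2 := `]a, b]%classic `*` `]c, d]%classic.

(** A pi-system that generates the measurable sets of the plane, with [sqbox] as exhaustion: the
    input for uniqueness of measures. *)
Definition boxes : set (set R2) :=
  [set B | exists a b c d, B = box a b c d].

Lemma measurable_box a b c d :
  measurable (box a b c d).
Proof. by apply: measurableX; exact: measurable_itv. Qed.

Lemma setI_closed_boxes : setI_closed boxes.
Proof.
move=> _ _ [a [b [c [d ->]]]] [a' [b' [c' [d' ->]]]].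
exists (Num.max a a'), (Num.min b b'), (Num.max c c'), (Num.min d d').
rewrite /box; apply/seteqP; split => -[x y]/=; rewrite !in_itv/= !gt_max !le_min.
  by move=> [[/andP[-> ->] /andP[-> ->]] [/andP[-> ->] /andP[-> ->]]].
by move=> [/andP[/andP[-> ->] /andP[-> ->]] /andP[/andP[-> ->] /andP[-> ->]]].
Qed.

Lemma bigcup_oc : \bigcup_n `]- n%:R, n%:R]%classic = [set: R].
Proof.
apply/seteqP; split => // x _; exists (Num.truncn `|x|).+1 => //=.
have := truncnS_gt `|x|; rewrite in_itv/= ltr_norml => /andP[-> /ltW ->].
by [].
Qed.

(** The sets A whose cylinder over A lies in the generated sigma-algebra form a sigma-algebra
    containing the half-open intervals, hence all measurable sets. Measurable rectangles are
    intersections of two cylinders. *)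
Lemma measurable_boxes : @measurable _ (measurableTypeR R * measurableTypeR R)%type
  = <<s boxes >>.
Proof.
have sB : sigma_algebra setT <<s boxes >> by exact: smallest_sigma_algebra.
have [s0 sD sU] := sB.
have sC A : <<s boxes >> A -> <<s boxes >> (~` A).
  by move=> /sD; rewrite setTD.
have sI A B : <<s boxes >> A -> <<s boxes >> B -> <<s boxes >> (A `&` B).
  move=> hA hB; rewrite -[A]setCK -[B]setCK -setCU -bigcup2E; apply: (sC _).
  by apply: sU => -[|[|n]] /=; [exact: sC|exact: sC|].
have sfst : @measurable _ (measurableTypeR R) `<=` [set A | <<s boxes >> (A `*` [set: R])].
  apply: smallest_sub.
    split => /=.
    - by rewrite set0X.
    - move=> A /sC; congr (<<s boxes >> _).
      by apply/seteqP; split => -[x y] /=; tauto.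
    - move=> F /sU; congr (<<s boxes >> _).
      apply/seteqP; split => -[x y] /=.
        by move=> [i _ [? _]]; split => //; exists i.
      by move=> [[i _ ?] _]; exists i.
  move=> _ [[a b] _ <-] /=; rewrite -bigcup_oc setX_bigcupr.
  apply: sU => n; apply: sub_sigma_algebra.
  by exists a, b, (- n%:R), n%:R.
have ssnd : @measurable _ (measurableTypeR R) `<=` [set A | <<s boxes >> ([set: R] `*` A)].
  apply: smallest_sub.
    split => /=.
    - by rewrite setX0.
    - move=> A /sC; congr (<<s boxes >> _).
      by apply/seteqP; split => -[x y] /=; tauto.
    - move=> F /sU; congr (<<s boxes >> _).
      apply/seteqP; split => -[x y] /=.
        by move=> [i _ [_ ?]]; split => //; exists i.
      by move=> [_ [i _ ?]]; exists i.
  move=> _ [[a b] _ <-] /=; rewrite -bigcup_oc setX_bigcupl.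
  apply: sU => n; apply: sub_sigma_algebra.
  by exists (- n%:R), n%:R, a, b.
rewrite measurable_prod_measurableType; apply/seteqP; split.
  apply: smallest_sub => // _ [A mA [B mB <-]].
  rewrite -[A]setIT -[B]setTI setXI; apply: sI; [exact: sfst|exact: ssnd].
apply: smallest_sub; first exact: smallest_sigma_algebra.
move=> _ [a [b [c [d ->]]]]; apply: sub_sigma_algebra.
exists `]a, b]%classic; first exact: measurable_itv.
by exists `]c, d]%classic => //; exact: measurable_itv.
Qed.

Lemma mu2_box a b c d : (mu2 (box a b c d) < +oo)%E.
Proof.
have H p q : mu `]p, q]%classic \is a fin_num.
  by rewrite lebesgue_measure_itv/=; case: ifP.
rewrite product_measure1E; [|exact: measurable_itv..].
by rewrite ltey_eq fin_numM//; exact: H.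
Qed.

Definition sqbox (n : nat) : set R2 := box (- n%:R) n%:R (- n%:R) n%:R.

Lemma bigcup_sqbox : \bigcup_n sqbox n = setT.
Proof.
apply/seteqP; split => // -[x y] _.
exists (maxn (Num.truncn `|x|).+1 (Num.truncn `|y|).+1) => //.
have H (z : R) k : ((Num.truncn `|z|).+1 <= k)%N -> - k%:R < z <= k%:R.
  move=> zk; have : `|z| < k%:R by apply: lt_le_trans (truncnS_gt _) _; rewrite ler_nat.
  by rewrite ltr_norml => /andP[-> /ltW ->].
by split; rewrite /= in_itv/=; apply: H; rewrite ?leq_maxl ?leq_maxr.
Qed.

(** The measures with densities F^+ and F^- agree on boxes, hence on all measurable sets. So F^+ =
    F^- almost everywhere on each [sqbox], which forces F = 0 there. *)
Lemma box_ae0 (F : R * R -> R) : measurable_fun setT F ->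
  (forall a b c d, mu2.-integrable (box a b c d) (EFin \o F)) ->
  (forall a b c d, \int[mu2]_(x in box a b c d) (F x)%:E = 0)%E ->
  {ae mu2, forall x, F x = 0}.
Proof.
move=> mF iF F0.
have mF' : measurable_fun setT (EFin \o F) by exact/measurable_EFinP.
pose m1 := density_measure mu2 (measurable_funepos mF') (fun x => funepos_ge0 _ x).
pose m2 := density_measure mu2 (measurable_funeneg mF') (fun x => funeneg_ge0 _ x).
have m12 A : boxes A -> m1 A = m2 A.
  move=> [a [b [c [d ->]]]]; have mB := measurable_box a b c d.
  have fp := integrable_pos_fin_num mB (iF a b c d).
  have fn := integrable_neg_fin_num mB (iF a b c d).
  have : (\int[mu2]_(x in box a b c d) (EFin \o F) x = 0)%E by exact: F0.
  rewrite integralE -(fineK fp) -(fineK fn) -EFinB => -[/eqP].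
  rewrite subr_eq0 => /eqP e.
  by rewrite -[LHS](fineK fp) -[RHS](fineK fn) e.
have E (A : set R2) : measurable A -> m1 A = m2 A.
  move=> mA; apply: (measure_unique boxes sqbox measurable_boxes setI_closed_boxes
    _ _ m1 m2 m12 _ A mA).
  - by move=> n; exists (- n%:R), n%:R, (- n%:R), n%:R.
  - exact: bigcup_sqbox.
  - move=> n; have mB := measurable_box (- n%:R) n%:R (- n%:R) n%:R.
    by have := integrable_pos_fin_num mB (iF _ _ _ _); rewrite ge0_fin_numE ?integral_ge0.
have aeN n : {ae mu2, forall x, sqbox n x -> F x = 0}.
  have mB := measurable_box (- n%:R) n%:R (- n%:R) n%:R.
  have : ae_eq mu2 (sqbox n) (EFin \o F)^\+%E (EFin \o F)^\-%E.
    apply: (integral_ae_eq mB).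
    - exact: (integrable_funepos mB (iF _ _ _ _)).
    - exact: measurable_funTS (measurable_funeneg mF').
    - by move=> B _ mB'; exact: E.
  apply: filterS => x /[apply].
  rewrite funeposE funenegE => h.
  have : Num.max (F x) 0 = Num.max (- F x) 0 by apply: EFin_inj; rewrite !EFin_max.
  by case: (leP (F x) 0) => ?; case: (leP (- F x) 0) => ?; lra.
have : {ae mu2, forall x n, sqbox n x -> F x = 0} by exact: ae_foralln.
apply: filterS => x Hx.
have : [set: R * R] x by [].
by rewrite -bigcup_sqbox => -[n _ /Hx].
Qed.

End boxes.

(** * Square-integrable functions *)

Section square_integrable.
Variable R : realType.
Notation mu := (@lebesgue_measure R).
Notation mu2 := (@lebesgue_measure R \x @lebesgue_measure R)%E.
Notation R2 := (measurableTypeR R * measurableTypeR R)%type.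
Implicit Types f g : R * R -> R.

Definition sqint f := measurable_fun setT f /\
  mu2.-integrable setT (fun x => (f x ^+ 2)%:E).

(** Being real-valued, this is 0 by default when the integral diverges; it is the squared L^2 norm
    only for [sqint] functions. *)
Definition nsq f : R := \int[mu2]_x (f x ^+ 2).

Lemma nsq_ge0 f : 0 <= nsq f.
Proof. by apply: Rintegral_ge0 => x _; exact: sqr_ge0. Qed.

Lemma EFin_nsq f : sqint f -> ((nsq f)%:E = \int[mu2]_x (f x ^+ 2)%:E)%E.
Proof.
by move=> [_ fi]; rewrite /nsq /Rintegral fineK//; exact: integrable_fin_num.
Qed.

Lemma measurable_mul2 f g : measurable_fun setT f -> measurable_fun setT g ->
  measurable_fun (setT : set R2) (EFin \o (fun x => f x * g x)).
Proof. by move=> mf mg; apply/measurable_EFinP; exact: measurable_funM. Qed.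

Lemma sqintM f g : sqint f -> sqint g ->
  mu2.-integrable setT (EFin \o (fun x => f x * g x)).
Proof.
move=> [mf fi] [mg gi].
apply: (le_integrable measurableT _ _ (integrableD measurableT fi gi)).
  exact: measurable_mul2.
move=> x _ /=; rewrite lee_fin normrM [leRHS]ger0_norm ?addr_ge0 ?sqr_ge0//.
rewrite -(real_normK (num_real (f x))) -(real_normK (num_real (g x))).
have := sqr_ge0 (`|f x| - `|g x|); have := normr_ge0 (f x); have := normr_ge0 (g x); nra.
Qed.

Lemma sqint_le f g : measurable_fun setT f -> (forall x, `|f x| <= `|g x|) ->
  sqint g -> sqint f.
Proof.
move=> mf fg [mg gi]; split => //.
apply: (le_integrable measurableT _ _ gi).
  by apply: (@measurable_mul2 f f).
by move=> x _ /=; rewrite lee_fin !normrX lerXn2r ?nnegrE.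
Qed.

Lemma sqintD f g : sqint f -> sqint g -> sqint (fun x => f x + g x).
Proof.
move=> sf sg; have [mf fi] := sf; have [mg gi] := sg.
have i2 := integrableZl measurableT 2 (sqintM sf sg).
have := integrableD measurableT (integrableD measurableT fi gi) i2.
move=> H; split; first exact: measurable_funD.
apply: eq_integrable H => // x _ /=.
by rewrite -EFinM -!EFinD; congr EFin; ring.
Qed.

Lemma sqintN f : sqint f -> sqint (fun x => - f x).
Proof.
move=> [mf fi]; apply: (@sqint_le _ f) => //.
  exact: measurableT_comp mf.
by move=> x; rewrite normrN.
Qed.

Lemma sqintB f g : sqint f -> sqint g -> sqint (fun x => f x - g x).
Proof. by move=> sf sg; exact: (sqintD sf (sqintN sg)). Qed.

Lemma sqint_translate v f : sqint f -> sqint (fun x => f (x + v)).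
Proof.
move=> [mf fi]; split; first exact: measurable_translate.
exact: (@integrable_translate _ v (fun x => (f x ^+ 2)%:E)).
Qed.

Lemma Rintegral_translate v f : measurable_fun setT f ->
  \int[mu2]_x f ((x : R * R) + v) = \int[mu2]_x f x.
Proof.
move=> mf; rewrite /Rintegral; congr fine.
by apply: (@integral_translate _ v (EFin \o f)); exact/measurable_EFinP.
Qed.

Lemma nsq_translate v f : sqint f -> nsq (fun x => f (x + v)) = nsq f.
Proof.
move=> [mf _]; apply: (@Rintegral_translate v (fun x => f x ^+ 2)).
exact: measurable_funX.
Qed.

(** Young's inequality with a free weight. It is used with l = 1, with l = 1/s to balance an
    increment of size s, and with l = 4 r for the helicity. *)
Lemma int_norm_mul_le f g (l : R) : 0 < l -> sqint f -> sqint g ->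
  \int[mu2]_x `|f x * g x| <= (l * nsq f + l^-1 * nsq g) / 2.
Proof.
move=> l0 sf sg; have [mf fi] := sf; have [mg gi] := sg.
have ifg := sqintM sf sg.
have i1 : mu2.-integrable setT (EFin \o (fun x => (l / 2) * f x ^+ 2)).
  exact: (integrableZl measurableT (l / 2) fi).
have i2 : mu2.-integrable setT (EFin \o (fun x => (l^-1 / 2) * g x ^+ 2)).
  exact: (integrableZl measurableT (l^-1 / 2) gi).
have -> : (l * nsq f + l^-1 * nsq g) / 2 =
    \int[mu2]_x ((l / 2) * f x ^+ 2 + (l^-1 / 2) * g x ^+ 2).
  rewrite RintegralD// !RintegralZl// /nsq; ring.
apply: le_Rintegral => //.
- exact: integrable_norm.
- exact: (integrableD measurableT i1 i2).
- move=> x _; rewrite normrM.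
  rewrite -(real_normK (num_real (f x))) -(real_normK (num_real (g x))).
  set p := `|f x|; set q := `|g x|.
  have -> : l / 2 * p ^+ 2 + l^-1 / 2 * q ^+ 2 = p * q + l / 2 * (p - l^-1 * q) ^+ 2.
    by field; rewrite gt_eqF.
  by rewrite lerDl mulr_ge0 ?sqr_ge0// divr_ge0// ltW.
Qed.

Lemma norm_int_mul_le f g (l : R) : 0 < l -> sqint f -> sqint g ->
  `|\int[mu2]_x (f x * g x)| <= (l * nsq f + l^-1 * nsq g) / 2.
Proof.
move=> l0 sf sg; apply: le_trans (int_norm_mul_le l0 sf sg).
exact: (le_normr_Rintegral measurableT (sqintM sf sg)).
Qed.

Lemma sqint_box f (a b c d : R) : sqint f ->
  mu2.-integrable (box a b c d) (EFin \o f).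
Proof.
move=> [mf fi]; have mB := measurable_box a b c d.
have i1 : mu2.-integrable (box a b c d) (cst 1%E).
  apply/integrableP; split; first exact: measurable_cst.
  under eq_integral do rewrite /= normr1.
  by rewrite integral_cst// mul1e; exact: mu2_box.
have i2 : mu2.-integrable (box a b c d) (fun x => (f x ^+ 2)%:E).
  exact: (integrableS measurableT mB _ fi).
apply: (le_integrable mB _ _ (integrableD mB i1 i2)).
  by apply/measurable_EFinP; exact: measurable_funTS.
move=> x _ /=; rewrite lee_fin [leRHS]ger0_norm ?addr_ge0 ?sqr_ge0//.
rewrite -(real_normK (num_real (f x))).
by have := sqr_ge0 (`|f x| - 1); have := normr_ge0 (f x); nra.
Qed.

(** A bound independent of [k], for dominated convergence. The margin on the right covers the
    supports; the one on the left is there because [box] omits its left edges. *)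
Lemma soft_box_le (a b c d : R) k (x : R * R) :
  0 <= soft_box a b c d k x <= \1_(box (a - 1) (b + 1) (c - 1) (d + 1)) x.
Proof.
rewrite /soft_box mulr_ge0 ?soft_indic_ge0//= indicE.
have [_|/negP H] := boolP (x \in box _ _ _ _).
  by rewrite mulr_ile1 ?soft_indic_ge0 ?soft_indic_le1.
suff -> : soft_indic a b k x.1 * soft_indic c d k x.2 = 0 by [].
have [x1|x1] := boolP (x.1 \in `[a, b + 1]); last by rewrite soft_indic_out// mul0r.
have [x2|x2] := boolP (x.2 \in `[c, d + 1]); last by rewrite [X in _ * X]soft_indic_out// mulr0.
exfalso; apply: H; rewrite inE; move: x1 x2; rewrite !in_itv/= => /andP[? ?] /andP[? ?].
by split; rewrite /= in_itv/=; apply/andP; split; lra.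
Qed.

Lemma measurable_soft_box (a b c d : R) k : measurable_fun (setT : set R2) (soft_box a b c d k).
Proof.
have m p q : measurable_fun (setT : set (measurableTypeR R)) (soft_indic p q k).
  apply: continuous_measurable_fun; exact: smooth1_continuous (smooth1_soft_indic p q k).
apply: measurable_funM.
  exact: (measurableT_comp (m a b) measurable_fst).
exact: (measurableT_comp (m c d) measurable_snd).
Qed.

Lemma sqint_indic_box (a b c d : R) : sqint (\1_(box a b c d)).
Proof.
have mB := measurable_box a b c d.
split; first exact: measurable_indic.
have : mu2.-integrable setT (EFin \o \1_(box a b c d)).
  apply/integrableP; split; first by apply/measurable_EFinP; exact: measurable_indic.
  rewrite (eq_integral (fun x => (\1_(box a b c d) x)%:E)); last first.
    by move=> x _ /=; rewrite ger0_norm.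
  by rewrite integral_indic// setIT; exact: mu2_box.
by apply: eq_integrable => // x _ /=; rewrite indicE expr2 -natrM mulnb andbb.
Qed.

Lemma sqint_soft_box (a b c d : R) k : sqint (soft_box a b c d k).
Proof.
apply: sqint_le (sqint_indic_box (a - 1) (b + 1) (c - 1) (d + 1)).
  exact: measurable_soft_box.
move=> x; have /andP[h1 h2] := soft_box_le a b c d k x.
by rewrite (ger0_norm h1) ger0_norm// (le_trans h1 h2).
Qed.

Lemma soft_box_cvg (a b c d : R) (x : R * R) :
  soft_box a b c d k x @[k --> \oo] --> (\1_(box a b c d) x : R).
Proof.
have -> : \1_(box a b c d) x = \1_(`]a, b]) x.1 * \1_(`]c, d]) x.2 :> R.
  rewrite !indicE -natrM mulnb; congr (_%:R); congr nat_of_bool.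
  by apply/idP/andP => [/set_mem[? ?]|[/set_mem ? /set_mem ?]]; [split|];
    apply/mem_set.
by apply: cvgM; exact: soft_indic_cvg.
Qed.

(** Dominated convergence in [k] turns the hypothesis into vanishing integrals over boxes, the
    hypothesis of [box_ae0]. *)
Lemma soft_box_ae0 F : sqint F ->
  (forall a b c d k, \int[mu2]_x (F x * soft_box a b c d k x) = 0) ->
  {ae mu2, forall x, F x = 0}.
Proof.
move=> sF F0; have [mF _] := sF.
apply: box_ae0 => [//|a b c d|a b c d]; first exact: sqint_box.
have mB := measurable_box a b c d.
have iE k : (\int[mu2]_x (F x * soft_box a b c d k x)%:E = 0)%E.
  have := integrable_fin_num measurableT (sqintM sF (sqint_soft_box a b c d k)).
  by move=> /fineK <-; exact: (congr1 EFin (F0 a b c d k)).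
have sb := sqint_indic_box (a - 1) (b + 1) (c - 1) (d + 1).
pose f_ k x := (F x * soft_box a b c d k x)%:E.
pose f x := (F x * \1_(box a b c d) x)%:E.
have dom : [/\ mu2.-integrable setT f,
    [sequence \int[mu2]_x `|f_ n x - f x|]_n @ \oo --> 0 &
    [sequence \int[mu2]_x f_ n x]_n @ \oo --> \int[mu2]_x f x]%E.
  apply: (@dominated_convergence _ _ _ mu2 setT measurableT f_ f
    (abse \o (EFin \o (fun x => F x * \1_(box (a - 1) (b + 1) (c - 1) (d + 1)) x)))).
  - by move=> k; exact: measurable_mul2 mF (measurable_soft_box a b c d k).
  - exact: measurable_mul2 mF (measurable_indic mB).
  - apply: aeW => x _; apply: cvg_EFin; first exact: nearW.
    by apply: cvgMr; exact: soft_box_cvg.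
  - exact/integrable_abse/sqintM.
  - apply: aeW => x k _ /=; rewrite lee_fin normrM [leRHS]normrM ler_wpM2l//.
    have /andP[h1 h2] := soft_box_le a b c d k x.
    by rewrite (ger0_norm h1) ger0_norm// (le_trans h1 h2).
have [_ _] := dom.
rewrite (_ : [sequence _]_n = fun=> 0%E); last by apply/funext => k; exact: iE.
move=> /(cvg_unique _ (cvg_cst _)) => /(_ (@ereal_hausdorff R)) H.
transitivity (\int[mu2]_x f x)%E; last exact/esym/H.
rewrite integral_mkcond; apply: eq_integral => x _.
rewrite /f patchE indicE.
by case: ifP; rewrite /= ?mulr1 ?mulr0.
Qed.

End square_integrable.

(** * Increments along a line *)

Section line_integral.
Variable R : realType.
Notation mu := (@lebesgue_measure R).
Notation mu2 := (@lebesgue_measure R \x @lebesgue_measure R)%E.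
Notation R1 := (measurableTypeR R).
Notation R2 := (measurableTypeR R * measurableTypeR R)%type.
Implicit Types (f g : R * R -> R) (e : R * R) (t : R).

Lemma mu2_sigma_finite : sigma_finite setT mu2.
Proof.
exists (@sqbox R); first by rewrite bigcup_sqbox.
by move=> n; split; [exact: measurable_box|exact: mu2_box].
Qed.

(* Unification does not find the sigma-finite structure of a product measure
   built on [lebesgue_measure], hence the explicit packing. *)
Definition leb2_sigma_finite : {sigma_finite_measure set R2 -> \bar R} :=
  HB.pack mu2 (Measure_isSigmaFinite.Build _ _ _ mu2 mu2_sigma_finite).

Lemma tonelli3 (K : R2 * R1 -> \bar R) : measurable_fun setT K ->
  (forall z, 0 <= K z)%E ->
  (\int[mu2]_x \int[mu]_s K (x, s) = \int[mu]_s \int[mu2]_x K (x, s))%E.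
Proof.
move=> mK K0; exact: (@fubini_tonelli _ _ R2 R1 R leb2_sigma_finite mu K mK K0).
Qed.

Lemma fubini3 (K : R2 * R1 -> \bar R) : measurable_fun setT K ->
  (\int[mu]_s \int[mu2]_x `|K (x, s)| < +oo)%E ->
  [/\ {ae mu2, forall x, mu.-integrable setT (fun s => K (x, s))},
    measurable_fun (setT : set R2) (fun x => \int[mu]_s K (x, s))%E,
    mu.-integrable setT (fun s => \int[mu2]_x K (x, s))%E &
    (\int[mu2]_x \int[mu]_s K (x, s) = \int[mu]_s \int[mu2]_x K (x, s))%E].
Proof.
move=> mK Koo.
have iK := (@integrable21ltyP _ _ R2 R1 R leb2_sigma_finite mu K mK).2 Koo.
split.
- exact: (@ae_integrable1 _ _ R2 R1 R leb2_sigma_finite mu K iK).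
- exact: (@measurable_fubini_F _ _ R2 R1 R leb2_sigma_finite mu K iK).
- have mG := @measurable_fubini_G _ _ R2 R1 R leb2_sigma_finite mu K iK.
  have maK : measurable_fun (setT : set (R2 * R1)) (abse \o K) by exact: measurableT_comp.
  have maG : measurable_fun (setT : set R1) (fun s => \int[mu2]_x `|K (x, s)|)%E.
    exact: (@measurable_fun_fubini_tonelli_G _ _ R2 R1 R leb2_sigma_finite (abse \o K)%E
      maK (fun z => abse_ge0 (K z))).
  apply/integrableP; split; first exact: mG.
  apply: le_lt_trans Koo; apply: ge0_le_integral => //.
    by apply: measurableT_comp => //; exact: mG.
  move=> s _; apply: le_abse_integral => //.
  by move/measurable_fun_pair1 : mK => /(_ s).
- exact: (@Fubini _ _ R2 R1 R leb2_sigma_finite mu K iK).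
Qed.

Definition line_int t e g (x : R * R) : R := \int[mu]_(s in `[0, t]) g (x + s *: e).

(** Moves the domain into the integrand, so that Fubini's theorem can be applied on the whole
    product of plane and line. *)
Lemma integral_indicM (D : set R1) (h : R -> R) :
  (\int[mu]_(s in D) (h s)%:E = \int[mu]_s (\1_D s * h s)%:E)%E.
Proof.
rewrite integral_mkcond; apply: eq_integral => s _.
by rewrite patchE indicE; case: ifP; rewrite ?mul1r ?mul0r.
Qed.

Lemma Rintegral_indicM (D : set R1) (h : R -> R) :
  \int[mu]_(s in D) h s = \int[mu]_s (\1_D s * h s).
Proof. by rewrite /Rintegral integral_indicM. Qed.

Lemma measurable_line e : measurable_fun (setT : set (R2 * R1))
  ((fun z => z.1 + z.2 *: e) : R2 * R1 -> R2).
Proof.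
apply/measurable_fun_pairP; split => /=.
  apply: (measurable_funD (measurableT_comp measurable_fst measurable_fst)).
  exact: (measurable_funM measurable_snd (@measurable_cst _ _ _ _ _ e.1)).
apply: (measurable_funD (measurableT_comp measurable_snd measurable_fst)).
exact: (measurable_funM measurable_snd (@measurable_cst _ _ _ _ _ e.2)).
Qed.

Lemma measurable_lineM t e g : measurable_fun setT g ->
  measurable_fun (setT : set (R2 * R1))
    (fun z => \1_(`[0, t]%classic : set R1) z.2 * g (z.1 + z.2 *: e)).
Proof.
move=> mg; apply: measurable_funM.
  have mi : measurable_fun (setT : set R1) (\1_(`[0, t]%classic : set R1) : R1 -> R).
    by apply: measurable_indic; exact: measurable_itv.
  exact: (measurableT_comp mi measurable_snd).
exact: (measurableT_comp mg (measurable_line e)).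
Qed.

Lemma measurable_line1 e g (x : R * R) : measurable_fun setT g ->
  measurable_fun (setT : set R1) (fun s => g (x + s *: e)).
Proof.
move=> mg.
have := measurableT_comp mg (measurable_line e).
move/measurable_fun_pair2 => /(_ x); exact.
Qed.

(** Here [g] may fail to be integrable along some lines. The positive and negative parts have
    measurable partial integrals by Tonelli, and [line_int] is the real part of their difference,
    default values included. *)
Lemma measurable_line_int t e g : measurable_fun setT g ->
  measurable_fun (setT : set R2) (line_int t e g).
Proof.
move=> mg.
pose K := (EFin \o (fun z : R2 * R1 =>
  \1_(`[0, t]%classic : set R1) z.2 * g (z.1 + z.2 *: e))).
have mK : measurable_fun (setT : set (R2 * R1)) K by apply/measurable_EFinP; exact: measurable_lineM.
have -> : line_int t e g = fine \o (fun x => fubini_F mu K^\+ x - fubini_F mu K^\- x)%E.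
  apply/funext => x /=; rewrite /line_int Rintegral_indicM /Rintegral; congr fine.
  rewrite integralE; congr (_ - _)%E; apply: eq_integral => s _.
    by rewrite !funeposE.
  by rewrite !funenegE.
apply: (measurableT_comp (fine_measurable _)) => //.
apply: emeasurable_funB; apply: measurable_fun_fubini_tonelli_F => //.
  exact: measurable_funepos.
exact: measurable_funeneg.
Qed.

(** The Cauchy-Schwarz inequality against the constant 1. It is trivial when the right-hand side is
    infinite; otherwise it says that a variance is nonnegative. *)
Lemma Rintegral_sqr_le (h : R -> R) t : 0 < t -> measurable_fun (setT : set R1) h ->
  (((\int[mu]_(s in `[0, t]) h s) ^+ 2)%:E
    <= t%:E * \int[mu]_(s in `[0%R, t]) (h s ^+ 2)%:E)%E.
Proof.
move=> t0 mh.
have mI : measurable (`[0, t]%classic : set R1) by exact: measurable_itv.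
have muI : mu `[0, t]%classic = t%:E.
  by rewrite lebesgue_measure_itv/= lte_fin t0 sube0.
have mh2 : measurable_fun (`[0, t]%classic : set R1) (EFin \o (fun s => h s ^+ 2)).
  by apply/measurable_EFinP/measurable_funX; exact: measurable_funTS.
have [ioo|ioo] := ltP (\int[mu]_(s in `[0%R, t]) (h s ^+ 2)%:E)%E +oo%E; last first.
  move: ioo; rewrite leye_eq => /eqP ->.
  by rewrite mulry gtr0_sg// mul1e leey.
have ih2 : mu.-integrable `[0, t] (EFin \o (fun s => h s ^+ 2)).
  apply/integrableP; split => //; apply: le_lt_trans ioo.
  rewrite le_eqVlt; apply/orP; left; apply/eqP; apply: eq_integral => s _.
  by rewrite /= ger0_norm ?sqr_ge0.
have i1 (c : R) : mu.-integrable `[0, t] (EFin \o cst c).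
  apply/integrableP; split; first by apply/measurable_EFinP; exact: measurable_cst.
  rewrite /= integral_cst//.
  by rewrite [X in (_ * X)%E](_ : _ = t%:E) ?muI// -EFinM ltry.
have ih : mu.-integrable `[0, t] (EFin \o h).
  apply: (le_integrable mI _ _ (integrableD mI (i1 1) ih2)).
    by apply/measurable_EFinP; exact: measurable_funTS.
  move=> x _ /=; rewrite lee_fin [leRHS]ger0_norm ?addr_ge0 ?sqr_ge0//.
  rewrite -(real_normK (num_real (h x))).
  by have := sqr_ge0 (`|h x| - 1); have := normr_ge0 (h x); nra.
have -> : (\int[mu]_(s in `[0%R, t]) (h s ^+ 2)%:E)%E
    = (\int[mu]_(s in `[0, t]) (h s ^+ 2))%:E.
  by rewrite /Rintegral fineK//; exact: integrable_fin_num.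
rewrite -EFinM lee_fin; set G := (X in X ^+ 2 <= _).
(* With [c] the mean of [h], the integral of (h - c)^2 equals Q - G^2 / t. *)
set Q := (X in _ <= _ * X); pose c := G / t.
have : 0 <= \int[mu]_(s in `[0, t]) (h s - c) ^+ 2.
  by apply: Rintegral_ge0 => s _; exact: sqr_ge0.
have ic : mu.-integrable `[0, t] (EFin \o (fun s => (- 2 * c) * h s)).
  exact: (integrableZl mI (- 2 * c) ih).
have ihc : mu.-integrable `[0, t] (EFin \o (fun s => h s ^+ 2 + (- 2 * c) * h s)).
  exact: (integrableD mI ih2 ic).
have -> : \int[mu]_(s in `[0, t]) (h s - c) ^+ 2 = Q - 2 * c * G + c ^+ 2 * t.
  transitivity (\int[mu]_(s in `[0, t]) ((h s ^+ 2 + (- 2 * c) * h s) + c ^+ 2)).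
    by apply: eq_Rintegral => s _; ring.
  rewrite RintegralD//; last exact: i1.
  have -> : \int[mu]_(s in `[0, t]) (c ^+ 2) = c ^+ 2 * t.
    by rewrite Rintegral_cst// [X in fine X](_ : _ = t%:E)//; exact: muI.
  rewrite RintegralD// RintegralZl// -/G -/Q; ring.
have -> : Q - 2 * c * G + c ^+ 2 * t = Q - G ^+ 2 / t.
  by rewrite /c; field; rewrite gt_eqF.
by rewrite subr_ge0 ler_pdivrMr// mulrC.
Qed.

(** One factor t comes from Cauchy-Schwarz on each segment. The other comes from Tonelli, since
    every slice in s has the integral [nsq g] by translation invariance. *)
Lemma sqint_line_int t e g : 0 < t -> sqint g ->
  sqint (line_int t e g) /\ nsq (line_int t e g) <= t ^+ 2 * nsq g.
Proof.
move=> t0 sg; have [mg gi] := sg.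
have mL := measurable_line_int t e mg.
have mg2 : measurable_fun setT (fun x => g x ^+ 2) by exact: measurable_funX.
pose K (z : R2 * R1) := (\1_(`[0, t]%classic : set R1) z.2 * g (z.1 + z.2 *: e) ^+ 2)%:E.
have mK : measurable_fun (setT : set (R2 * R1)) K.
  by apply/measurable_EFinP; exact: (@measurable_lineM t e (fun x => g x ^+ 2) mg2).
have K0 z : (0 <= K z)%E by rewrite lee_fin mulr_ge0 ?sqr_ge0.
have mFK : measurable_fun (setT : set R2) (fubini_F mu K).
  exact: (measurable_fun_fubini_tonelli_F K mK K0).
have bound : (\int[mu2]_x (line_int t e g x ^+ 2)%:E <= (t ^+ 2 * nsq g)%:E)%E.
  apply: (@le_trans _ _ (\int[mu2]_x (t%:E * fubini_F mu K x))%E).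
    apply: ge0_le_integral => //.
    - by move=> x _; rewrite lee_fin sqr_ge0.
    - by apply/measurable_EFinP; exact: measurable_funX.
    - exact: (emeasurable_funM (@measurable_cst _ _ _ _ _ t%:E) mFK).
    - move=> x _; apply: le_trans (Rintegral_sqr_le t0 (measurable_line1 e x mg)) _.
      by rewrite integral_indicM.
  have F0 (x : R2) : setT x -> (0 <= fubini_F mu K x)%E by move=> _; exact: integral_ge0.
  have t0' : (0%R <= t%:E)%E by rewrite lee_fin ltW.
  rewrite (ge0_integralZl _ measurableT mFK F0 t0').
  have -> : (\int[mu2]_x fubini_F mu K x = \int[mu]_s \int[mu2]_x K (x, s))%E.
    exact: tonelli3 mK K0.
  rewrite (eq_integral (fun s => (\1_(`[0, t]%classic : set R1) s * nsq g)%:E)); last first.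
    move=> s _; rewrite /K /= [RHS]EFinM EFin_nsq//.
    rewrite -(@ge0_integral_translate R (s *: e) (fun x => (g x ^+ 2)%:E)); last 2 first.
    - exact/measurable_EFinP.
    - by move=> x; rewrite lee_fin sqr_ge0.
    rewrite -ge0_integralZl//.
    - by apply/measurable_EFinP; exact: (measurable_translate (s *: e) mg2).
    - by move=> x _; rewrite lee_fin sqr_ge0.
  rewrite -integral_indicM integral_cst; last exact: measurable_itv.
  rewrite [X in (_ * (_ * X))%E](_ : _ = t%:E); last first.
    by rewrite [LHS]lebesgue_measure_itv/= lte_fin t0 sube0.
  rewrite -!EFinM lee_fin.
  by rewrite expr2 [nsq g * t]mulrC mulrA.
have sL : sqint (line_int t e g).
  split => //; apply/integrableP; split.
    by apply/measurable_EFinP; exact: measurable_funX.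
  apply: le_lt_trans (ltry (t ^+ 2 * nsq g)).
  apply: le_trans bound; rewrite le_eqVlt; apply/orP; left; apply/eqP.
  by apply: eq_integral => x _; rewrite gee0_abs// lee_fin sqr_ge0.
by split => //; rewrite -lee_fin EFin_nsq.
Qed.

End line_integral.

(** * From weak derivatives to increments *)

Section increments.
Variable R : realType.
Notation mu := (@lebesgue_measure R).
Notation mu2 := (@lebesgue_measure R \x @lebesgue_measure R)%E.
Notation R1 := (measurableTypeR R).
Notation R2 := (measurableTypeR R * measurableTypeR R)%type.
Implicit Types (f g u v w : R * R -> R) (e : R * R) (t : R).

Lemma line_int_swap t e f g : 0 < t -> sqint f -> sqint g ->
  mu.-integrable `[0, t] (EFin \o (fun s => \int[mu2]_x (f x * g (x + s *: e)))) /\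
  \int[mu2]_x (f x * line_int t e g x) =
  \int[mu]_(s in `[0, t]) \int[mu2]_x (f x * g (x + s *: e)).
Proof.
move=> t0 sf sg; have [mf _] := sf; have [mg _] := sg.
have mI : measurable (`[0, t]%classic : set R1) by exact: measurable_itv.
pose I := \1_(`[0, t]%classic : set R1) : R1 -> R.
pose W (z : R2 * R1) := (f z.1 * (I z.2 * g (z.1 + z.2 *: e)))%:E.
have mW : measurable_fun (setT : set (R2 * R1)) W.
  apply/measurable_EFinP; apply: measurable_funM; last exact: measurable_lineM.
  exact: (measurableT_comp mf measurable_fst).
have sgs s : sqint (fun x => g (x + s *: e)) by exact: sqint_translate.
have iI c : (\int[mu]_s (I s * c)%:E = (c * t)%:E)%E.
  rewrite -integral_indicM integral_cst//.
  rewrite [X in (_ * X)%E](_ : _ = t%:E); last first.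
    by rewrite [LHS]lebesgue_measure_itv/= lte_fin t0 sube0.
  by rewrite -EFinM.
have Woo : (\int[mu]_s \int[mu2]_x `|W (x, s)| < +oo)%E.
  apply: (@le_lt_trans _ _ (\int[mu]_s (I s * ((1 * nsq f + 1^-1 * nsq g) / 2))%:E)%E);
    last by rewrite iI ltry.
  apply: ge0_le_integral => //.
  - by move=> s _; exact: integral_ge0.
  - have maW : measurable_fun (setT : set (R2 * R1)) (abse \o W) by exact: measurableT_comp.
    exact: (@measurable_fun_fubini_tonelli_G _ _ R2 R1 R (@leb2_sigma_finite R) (abse \o W)%E
      maW (fun z => abse_ge0 (W z))).
  - apply/measurable_EFinP; apply: measurable_funM => //; exact: measurable_indic.
  - move=> s _.
    have -> : (\int[mu2]_x `|W (x, s)| =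
        (I s * \int[mu2]_x `|f x * g (x + s *: e)|)%:E)%E.
      have ifg := integrable_norm (sqintM sf (sgs s)).
      rewrite EFinM -[X in (_ * X)%E](_ : (\int[mu2]_x `|f x * g (x + s *: e)|%:E)%E = _);
        last by rewrite /Rintegral fineK//; exact: integrable_fin_num.
      rewrite -integralZl//; apply: eq_integral => x _.
      by rewrite /W /= mulrCA normrM [`|I s|]ger0_norm.
    rewrite lee_fin ler_wpM2l//.
    by have := int_norm_mul_le ltr01 sf (sgs s); rewrite nsq_translate.
have [aeW mWx iWs Wswap] := fubini3 mW Woo.
have inner s : (\int[mu2]_x W (x, s) = (I s * \int[mu2]_x (f x * g (x + s *: e)))%:E)%E.
  have ifg := sqintM sf (sgs s).
  rewrite EFinM -[X in (_ * X)%E](_ : (\int[mu2]_x (f x * g (x + s *: e))%:E)%E = _);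
    last by rewrite /Rintegral fineK//; exact: integrable_fin_num.
  rewrite -integralZl//; apply: eq_integral => x _.
  by rewrite /W /= mulrCA EFinM.
split.
  rewrite integrable_mkcond//.
  apply: eq_integrable iWs => // s _; rewrite inner patchE /I indicE.
  by case: ifP => _; rewrite ?mul1r ?mul0r.
rewrite Rintegral_indicM /Rintegral; congr fine.
transitivity (\int[mu]_s \int[mu2]_x W (x, s))%E; last first.
  by apply: eq_integral => s _; rewrite inner.
rewrite -Wswap; apply: ae_eq_integral => //.
  apply/measurable_EFinP; apply: measurable_funM => //; exact: measurable_line_int.
apply: filterS aeW => x iW _.
(* Integrability of the slice of [W] at x gives that of [g] along the line only where f(x) is
   nonzero; where f(x) = 0 both sides vanish. *)
have [fx0|fx0] := eqVneq (f x) 0.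
  rewrite fx0 mul0r (eq_integral (cst 0%E)) ?integral0// => s _.
  by rewrite /W /= fx0 mul0r.
have iK : mu.-integrable setT (EFin \o (fun s => I s * g (x + s *: e))).
  apply: eq_integrable (integrableZl measurableT (f x)^-1 iW) => // s _.
  by rewrite /W /=; congr EFin; rewrite mulKf.
rewrite /line_int Rintegral_indicM /Rintegral EFinM fineK//; last first.
  exact: (integrable_fin_num measurableT iK).
by rewrite -integralZl//; apply: eq_integral => s _; rewrite /W /= EFinM.
Qed.

(** In each slice in s, substitute x + s e for x. *)
Lemma line_int_adjoint t e f g : 0 < t -> sqint f -> sqint g ->
  \int[mu2]_x (f x * line_int t (- e) g x) = \int[mu2]_x (g x * line_int t e f x).
Proof.
move=> t0 sf sg; rewrite (line_int_swap _ t0 sf sg).2 (line_int_swap _ t0 sg sf).2.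
apply: eq_Rintegral => s _; have [mf _] := sf; have [mg _] := sg.
rewrite -(@Rintegral_translate R (s *: e) (fun x => f x * g (x + s *: - e))).
  by apply: eq_Rintegral => x _; rewrite scalerN addrK mulrC.
by apply: measurable_funM => //; exact: measurable_translate.
Qed.

(** The test function is the line integral of [phi] in direction -e, so the adjoint moves that
    integral onto [v]. The constant [c] is present because the weak gradient belongs to n, while
    only m = n - e3 is square-integrable; it drops out since [phi] and its translate have the same
    integral. *)
Lemma weak_partial_increment (j : 'I_2) u v (c t : R) : 0 < t ->
  weak_partial j (fun x => u x + c) v -> sqint u -> sqint v ->
  {ae mu2, forall x, u (x + t *: dir R j) - u x = line_int t (dir R j) v x}.
Proof.
move=> t0 [_ [_ wp]] su sv; set e := dir R j.
have [sL _] := sqint_line_int e t0 sv.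
have sut := sqint_translate (t *: e) su.
have sF := sqintB (sqintB sut su) sL.
have {}H : {ae mu2, forall x, u (x + t *: e) - u x - line_int t e v x = 0}; last first.
  apply: (@filterS _ _ (ae_filter_ringOfSetsType mu2) _ _ _ H) => x.
  exact: subr0_eq.
apply: (soft_box_ae0 sF) => a b c' d k; set phi := soft_box a b c' d k.
have sphi : sqint phi by exact: sqint_soft_box.
have [mphi _] := sphi; have [mu_ _] := su.
have [Phi [tPhi dPhi PhiE]] := soft_box_primitive a b c' d k j t0.
have PhiL x : Phi x = line_int t (- e) phi x.
  by rewrite PhiE; apply: eq_Rintegral => s _; rewrite scalerN.
have sphit : sqint (fun x => phi (x - t *: e)) by exact: sqint_translate.
have iphi : mu2.-integrable setT (EFin \o phi).
  have i1 := sqint_indic_box (a - 1) (b + 1) (c' - 1) (d + 1).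
  apply: (le_integrable measurableT _ _ (sqintM i1 i1)); first exact/measurable_EFinP.
  move=> x _; rewrite /= lee_fin.
  have /andP[h1 h2] := soft_box_le a b c' d k x.
  rewrite (ger0_norm h1) ger0_norm ?mulr_ge0//; apply: (le_trans h2).
  by rewrite indicE -natrM mulnb andbb.
have iphit : mu2.-integrable setT (EFin \o (fun x => phi (x - t *: e))).
  exact: (integrable_translate (- (t *: e)) iphi).
have lhs : \int[mu2]_x ((u x + c) * (phi x - phi (x - t *: e))) =
    \int[mu2]_x (u x * phi x) - \int[mu2]_x (u (x + t *: e) * phi x).
  have i1 := sqintM su sphi; have i2 := sqintM su sphit.
  have i12 := integrableB measurableT i1 i2.
  have i3 : mu2.-integrable setT (EFin \o (fun x => c * phi x)).
    exact: (integrableZl measurableT c iphi).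
  have i4 : mu2.-integrable setT (EFin \o (fun x => c * phi (x - t *: e))).
    exact: (integrableZl measurableT c iphit).
  have i34 := integrableB measurableT i3 i4.
  transitivity (\int[mu2]_x ((u x * phi x - u x * phi (x - t *: e)) +
      (c * phi x - c * phi (x - t *: e)))).
    by apply: eq_Rintegral => x _; ring.
  rewrite RintegralD// !RintegralB// !RintegralZl//.
  rewrite (@Rintegral_translate R (- (t *: e)) phi)// subrr addr0; congr (_ - _).
  rewrite -(@Rintegral_translate R (t *: e) (fun x => u x * phi (x - t *: e))).
    by apply: eq_Rintegral => x _; rewrite addrK.
  by apply: measurable_funM => //; exact: measurable_translate.
have rhs : \int[mu2]_x ((u x + c) * (phi x - phi (x - t *: e))) =
    - \int[mu2]_x (phi x * line_int t e v x).
  rewrite -line_int_adjoint//.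
  have := wp Phi tPhi => /(congr1 fine).
  rewrite fineN => wpE; rewrite /Rintegral.
  transitivity (fine (\int[@leb2 R]_x ((u x + c) * 'D_e Phi x)%:E)%E).
    by congr fine; apply: eq_integral => x _; rewrite dPhi.
  rewrite wpE; congr (- fine _); apply: eq_integral => x _; rewrite PhiL//.
have E := lhs; rewrite rhs in E.
transitivity (\int[mu2]_x (u (x + t *: e) * phi x - u x * phi x -
    phi x * line_int t e v x)).
  by apply: eq_Rintegral => x _; ring.
have i1 := sqintM sut sphi; have i2 := sqintM su sphi; have i3 := sqintM sphi sL.
have i12 := integrableB measurableT i1 i2.
rewrite RintegralB// RintegralB//; lra.
Qed.

End increments.

(** * Integration by parts *)

Section by_parts.
Variable R : realType.
Notation mu := (@lebesgue_measure R).
Notation mu2 := (@lebesgue_measure R \x @lebesgue_measure R)%E.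
Notation R1 := (measurableTypeR R).
Notation R2 := (measurableTypeR R * measurableTypeR R)%type.
Implicit Types (f g : R * R -> R).
Variables (e : R * R) (u u' w w' : R * R -> R).
Hypotheses (su : sqint u) (su' : sqint u') (sw : sqint w) (sw' : sqint w').
Hypothesis incu : forall t : R, 0 < t ->
  {ae mu2, forall x, u (x + t *: e) - u x = line_int t e u' x}.
Hypothesis incw : forall t : R, 0 < t ->
  {ae mu2, forall x, w (x + t *: e) - w x = line_int t e w' x}.

Lemma ae_eq_Rintegral f g : measurable_fun setT f -> measurable_fun setT g ->
  {ae mu2, forall x, f x = g x} -> \int[mu2]_x f x = \int[mu2]_x g x.
Proof.
move=> mf mg fg; rewrite /Rintegral; congr fine; apply: ae_eq_integral => //.
- exact/measurable_EFinP.
- exact/measurable_EFinP.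
- apply: (@filterS _ _ (ae_filter_ringOfSetsType mu2) _ _ _ fg) => x -> //.
Qed.

(** Symmetric in u and w, so the same constant bounds both pairings and the product of the two
    increments. *)
Let C := (nsq u' + nsq w') / 2.

Lemma nsq_increment (t : R) : 0 < t ->
  nsq (fun x => u (x + t *: e) - u x) <= t ^+ 2 * nsq u'.
Proof.
move=> t0; have [sL nL] := sqint_line_int e t0 su'.
apply: le_trans nL; rewrite le_eqVlt; apply/orP; left; apply/eqP.
have [mI _] := sqintB (sqint_translate (t *: e) su) su.
have [mL _] := sL.
apply: ae_eq_Rintegral; [exact: measurable_funX|exact: measurable_funX|].
by apply: (@filterS _ _ (ae_filter_ringOfSetsType mu2) _ _ _ (incu t0)) => x ->.
Qed.

(** Translations of w' are not controlled quantitatively, as w' is merely square-integrable.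
    Translation invariance moves the shift onto u, whose increment has norm O(s); Young's inequality
    with weight 1/s then yields a bound linear in s. *)
Lemma int_shift_sub_le (s : R) : 0 <= s ->
  `|\int[mu2]_x (u x * w' (x + s *: e)) - \int[mu2]_x (u x * w' x)| <= s * C.
Proof.
rewrite le_eqVlt => /predU1P[<-|s0].
  rewrite mul0r [X in X - _](_ : _ = \int[mu2]_x (u x * w' x)) ?subrr ?normr0//.
  by apply: eq_Rintegral => x _; rewrite scale0r addr0.
have sws := sqint_translate (s *: e) sw'.
have sus := sqint_translate (s *: e) su.
have [mu_ _] := su; have [mw_ _] := sw'.
rewrite -[X in _ - X](@Rintegral_translate R (s *: e)); last exact: measurable_funM.
rewrite -RintegralB//; [|exact: sqintM su sws|exact: sqintM sus sws].
rewrite [X in `|X|](_ : _ =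
    \int[mu2]_x ((u x - u (x + s *: e)) * w' (x + s *: e))); last first.
  by apply: eq_Rintegral => x _; rewrite mulrBl.
have s1 : 0 < s^-1 by rewrite invr_gt0.
apply: le_trans (norm_int_mul_le s1 (sqintB su sus) sws) _.
rewrite invrK nsq_translate// /C.
have -> : nsq (fun x => u x - u (x + s *: e)) = nsq (fun x => u (x + s *: e) - u x).
  by apply: eq_Rintegral => x _; rewrite -sqrrN opprB.
have : s^-1 * nsq (fun x => u (x + s *: e) - u x) <= s * nsq u'.
  by rewrite ler_pdivrMl// mulrA -expr2; exact: nsq_increment.
by set a := s^-1 * _; nra.
Qed.

Lemma int_line_int_sub_le (t : R) : 0 < t ->
  `|\int[mu2]_x (u x * line_int t e w' x) - t * \int[mu2]_x (u x * w' x)| <= t ^+ 2 * C.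
Proof.
move=> t0; have [iI ->] := line_int_swap e t0 su sw'.
have mI : measurable (`[0, t]%classic : set R1) by exact: measurable_itv.
have muI : mu `[0, t]%classic = t%:E.
  by rewrite lebesgue_measure_itv/= lte_fin t0 sube0.
have i1 (c : R) : mu.-integrable `[0, t] (EFin \o cst c).
  apply/integrableP; split; first by apply/measurable_EFinP; exact: measurable_cst.
  rewrite /= integral_cst//.
  by rewrite [X in (_ * X)%E](_ : _ = t%:E) ?muI// -EFinM ltry.
have Icst (c : R) : \int[mu]_(s in `[0, t]) c = t * c.
  by rewrite Rintegral_cst// [X in fine X](_ : _ = t%:E) ?muI//= mulrC.
rewrite -Icst -RintegralB//; last exact: i1.
have iD := integrableB mI iI (i1 (\int[mu2]_x (u x * w' x))).
apply: (le_trans (le_normr_Rintegral mI iD)).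
have -> : t ^+ 2 * C = \int[mu]_(s in `[0, t]) (t * C) by rewrite Icst mulrA expr2.
apply: le_Rintegral => //; [exact: integrable_norm|exact: i1|].
move=> s /=; rewrite in_itv/= => /andP[s0 st].
apply: (le_trans (int_shift_sub_le s0)).
by rewrite ler_wpM2r// divr_ge0// addr_ge0// nsq_ge0.
Qed.

(** The discrete product rule: the integrand is the increment of u w, and a translate of u w has the
    same integral as u w. *)
Lemma int_line_int_mul (t : R) : 0 < t ->
  \int[mu2]_x (u x * line_int t e w' x) + \int[mu2]_x (w x * line_int t e u' x)
  + \int[mu2]_x (line_int t e u' x * line_int t e w' x) = 0.
Proof.
move=> t0.
have [sLu _] := sqint_line_int e t0 su'; have [sLw _] := sqint_line_int e t0 sw'.
have sut := sqint_translate (t *: e) su; have swt := sqint_translate (t *: e) sw.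
have i1 := sqintM su sLw; have i2 := sqintM sw sLu; have i3 := sqintM sLu sLw.
have i12 := integrableD measurableT i1 i2.
have i123 := integrableD measurableT i12 i3.
have j1 := sqintM sut swt; have j2 := sqintM su sw.
have j12 := integrableB measurableT j1 j2.
rewrite -RintegralD// -RintegralD//.
transitivity (\int[mu2]_x (u (x + t *: e) * w (x + t *: e) - u x * w x)).
  apply: ae_eq_Rintegral.
  - by have /measurable_EFinP := measurable_int _ i123.
  - by have /measurable_EFinP := measurable_int _ j12.
  - apply: (@filterS2 _ _ (ae_filter_ringOfSetsType mu2) _ _ _ _ (incu t0) (incw t0)).
    by move=> x <- <-; ring.
rewrite RintegralB// (@Rintegral_translate R (t *: e) (fun x => u x * w x)) ?subrr//.
by have /measurable_EFinP := measurable_int _ j2.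
Qed.

End by_parts.

Lemma norm_mulD_le (R : realFieldType) (a b c p q t D : R) : a + b + c = 0 ->
  `|a - t * p| <= D -> `|b - t * q| <= D -> `|c| <= D -> `|t * (p + q)| <= 3 * D.
Proof.
move=> abc; rewrite !ler_norml mulrDr => /andP[? ?] /andP[? ?] /andP[? ?].
by apply/andP; split; lra.
Qed.

Lemma Rintegral_by_parts (R : realType) (e : R * R) (u u' w w' : R * R -> R) :
  let mu2 := (@lebesgue_measure R \x @lebesgue_measure R)%E in
  sqint u -> sqint u' -> sqint w -> sqint w' ->
  (forall t : R, 0 < t ->
    {ae mu2, forall x, u (x + t *: e) - u x = line_int t e u' x}) ->
  (forall t : R, 0 < t ->
    {ae mu2, forall x, w (x + t *: e) - w x = line_int t e w' x}) ->
  \int[mu2]_x (u x * w' x) = - \int[mu2]_x (w x * u' x).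
Proof.
move=> mu2 su su' sw sw' incu incw.
apply/eqP; rewrite -subr_eq0 opprK -normr_le0; apply/ler_addgt0Pr => d d0.
rewrite add0r; set X := _ + _.
pose C := (nsq u' + nsq w') / 2.
have C0 : 0 <= C by rewrite divr_ge0// addr_ge0// nsq_ge0.
(* The estimate below reads t |X| <= 3 t^2 C; after division by t, this choice makes 3 t C at most
   d. The added 1 keeps the denominator positive when C = 0. *)
pose t := d / (3 * C + 1).
have t0 : 0 < t by rewrite divr_gt0// ltr_wpDl// mulr_ge0.
have := int_line_int_sub_le su su' sw' incu t0.
have := int_line_int_sub_le sw sw' su' incw t0.
have := int_line_int_mul su su' sw sw' incu incw t0.
have [sLu nLu] := sqint_line_int e t0 su'; have [sLw nLw] := sqint_line_int e t0 sw'.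
have := norm_int_mul_le ltr01 sLu sLw; rewrite invr1 !mul1r.
rewrite [nsq w' + nsq u']addrC -/C.
set a := Rintegral _ _ _; set b := Rintegral _ _ _; set c := Rintegral _ _ _.
move=> h1 h2 h3 h4.
have h5 : `|a| <= t ^+ 2 * C by rewrite (le_trans h1)// /C mulrA mulrDr ler_pM2r ?invr_gt0// lerD.
have h6 : t * `|X| <= t * (t * (3 * C)).
  rewrite -[X in X * `|_|](gtr0_norm t0) -normrM.
  have -> : t * (t * (3 * C)) = 3 * (t ^+ 2 * C) by ring.
  exact: norm_mulD_le h2 h4 h3 h5.
rewrite ler_pM2l// in h6; apply: (le_trans h6).
rewrite /t mulrAC ler_pdivrMr; first by rewrite ler_pM2l// lerDl.
by rewrite ltr_wpDl// mulr_ge0.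
Qed.

(** * A Sobolev inequality in the plane *)

Section sobolev.
Variable R : realType.
Notation mu := (@lebesgue_measure R).
Notation mu2 := (@lebesgue_measure R \x @lebesgue_measure R)%E.
Notation R1 := (measurableTypeR R).
Notation R2 := (measurableTypeR R * measurableTypeR R)%type.
Implicit Types (f u v : R * R -> R) (e : R * R).

Definition line_nsq e f (x : R * R) : \bar R := (\int[mu]_s (f (x + (s : R) *: e)%R ^+ 2)%:E)%E.

(** Twice the squared H^1 norm of [u] along the line through x. Both factors 2 come from (a - b)^2
    <= 2 a^2 + 2 b^2. *)
Definition line_energy e u v (x : R * R) : \bar R :=
  (2%:E * line_nsq e u x + 2%:E * line_nsq e v x)%E.

Lemma line_nsq_ge0 e f x : (0 <= line_nsq e f x)%E.
Proof. by apply: integral_ge0 => s _; rewrite lee_fin sqr_ge0. Qed.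

Lemma line_energy_ge0 e u v x : (0 <= line_energy e u v x)%E.
Proof. by rewrite adde_ge0// mule_ge0// line_nsq_ge0. Qed.

Lemma measurable_line_sqr e f : measurable_fun setT f ->
  measurable_fun (setT : set (R2 * R1)) (fun z => (f (z.1 + z.2 *: e) ^+ 2)%:E).
Proof.
move=> mf; apply/measurable_EFinP/measurable_funX.
exact: (measurableT_comp mf (measurable_line e)).
Qed.

Lemma measurable_line_nsq e f : measurable_fun setT f ->
  measurable_fun (setT : set R2) (line_nsq e f).
Proof.
move=> mf.
have K0 (z : R2 * R1) : (0 <= (f (z.1 + z.2 *: e) ^+ 2)%:E)%E by rewrite lee_fin sqr_ge0.
exact: (@measurable_fun_fubini_tonelli_F _ _ R2 R1 R mu _ (measurable_line_sqr e mf) K0).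
Qed.

Lemma measurable_line_energy e u v : measurable_fun setT u -> measurable_fun setT v ->
  measurable_fun (setT : set R2) (line_energy e u v).
Proof.
move=> mf mg; apply: emeasurable_funD.
  exact: (emeasurable_funM (@measurable_cst _ _ _ _ _ 2%:E) (measurable_line_nsq e mf)).
exact: (emeasurable_funM (@measurable_cst _ _ _ _ _ 2%:E) (measurable_line_nsq e mg)).
Qed.

(* One-dimensional embedding of H^1 into L^oo along the direction [e], tested
   against an arbitrary weight: average the increment identity over t in ]0, 1]. *)
Lemma int_sqr_le_line_energy e u v (h : R * R -> \bar R) :
  sqint u -> sqint v ->
  (forall t : R, 0 < t ->
    {ae mu2, forall x, u (x + t *: e) - u x = line_int t e v x}) ->
  measurable_fun (setT : set R2) h -> (forall x, 0 <= h x)%E ->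
  (\int[mu2]_x (h x * (u x ^+ 2)%:E) <= \int[mu2]_x (h x * line_energy e u v x))%E.
Proof.
move=> [mu_ _] [mv _] inc mh h0.
have mI : measurable (`]0, 1]%classic : set R1) by exact: measurable_itv.
have mu2E f : measurable_fun setT f -> measurable_fun (setT : set R2) (fun x => (f x ^+ 2)%:E).
  by move=> mf; apply/measurable_EFinP; exact: measurable_funX.
have mhu := emeasurable_funM mh (mu2E _ mu_).
have hu0 x : (0 <= h x * (u x ^+ 2)%:E)%E by rewrite mule_ge0// lee_fin sqr_ge0.
pose K (z : R2 * R1) := (h z.1 * (2%:E * (u (z.1 + z.2 *: e) ^+ 2)%:E))%E.
have mK : measurable_fun (setT : set (R2 * R1)) K.
  apply: emeasurable_funM; first exact: (measurableT_comp mh measurable_fst).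
  exact: (emeasurable_funM (@measurable_cst _ _ _ _ _ 2%:E) (measurable_line_sqr e mu_)).
have K0 z : (0 <= K z)%E by rewrite !mule_ge0// lee_fin sqr_ge0.
have mKs s : measurable_fun (setT : set R2) (fun x => K (x, s)).
  by move/measurable_fun_pair1 : mK => /(_ s).
pose A (s : R) := (\int[mu2]_x K (x, s))%E.
have A0 s : (0 <= A s)%E by exact: integral_ge0.
have mA : measurable_fun (setT : set R1) A.
  exact: (@measurable_fun_fubini_tonelli_G _ _ R2 R1 R (@leb2_sigma_finite R) K mK K0).
have mB0 : measurable_fun (setT : set R2) (fun x => 2%:E * line_nsq e v x)%E.
  exact: (emeasurable_funM (@measurable_cst _ _ _ _ _ 2%:E) (measurable_line_nsq e mv)).
have mB := emeasurable_funM mh mB0.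
have B0' x : (0 <= 2%:E * line_nsq e v x)%E by rewrite mule_ge0// line_nsq_ge0.
have B0 x : (0 <= h x * (2%:E * line_nsq e v x))%E by rewrite mule_ge0.
pose B := (\int[mu2]_x (h x * (2%:E * line_nsq e v x)))%E.
have mAB : measurable_fun (setT : set R1) (fun s => A s + B)%E.
  exact: (emeasurable_funD mA (@measurable_cst _ _ _ _ _ B)).
have B_ge0 : (0 <= B)%E by exact: integral_ge0.
(* The exceptional null set of the increment identity depends on t, so x is integrated out first and
   the average over t is taken afterwards. The weight [h] lets the resulting integral inequality
   replace a pointwise bound. *)
have step (t : R) : 0 < t <= 1 -> (\int[mu2]_x (h x * (u x ^+ 2)%:E) <= A t + B)%E.
  move=> /andP[t0 t1]; rewrite /A /B -ge0_integralD//.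
  apply: ae_ge0_le_integral => //.
  - by move=> x _; rewrite adde_ge0.
  - exact: (emeasurable_funD (mKs t) mB).
  - apply: (@filterS _ _ (ae_filter_ringOfSetsType mu2) _ _ _ (inc t t0)) => x incx _.
    rewrite /K /= -ge0_muleDr//; last by rewrite mule_ge0// lee_fin sqr_ge0.
    apply: lee_wpmul2l => //.
    have : ((line_int t e v x ^+ 2)%:E <= line_nsq e v x)%E.
      apply: le_trans (Rintegral_sqr_le t0 (measurable_line1 e x mv)) _.
      apply: (@le_trans _ _ (1%:E * \int[mu]_(s in `[0%R, t]) (v (x + s *: e)%R ^+ 2)%:E)%E).
        apply: lee_wpmul2r; last by rewrite lee_fin.
        by apply: integral_ge0 => s _; rewrite lee_fin sqr_ge0.
      rewrite mul1e; apply: ge0_subset_integral => //.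
      - by apply/measurable_EFinP/measurable_funX; exact: measurable_line1.
      - by move=> s _; rewrite lee_fin sqr_ge0.
    move=> H; apply: (@le_trans _ _ (2%:E * (u (x + t *: e) ^+ 2)%:E +
        2%:E * (line_int t e v x ^+ 2)%:E)%E).
      rewrite -!EFinM -EFinD lee_fin -incx.
      (* The right-hand side minus the left-hand side is exactly this square. *)
      have := sqr_ge0 (2 * u (x + t *: e) - u x); nra.
    by rewrite leeD2l// lee_wpmul2l.
have muI : mu `]0, 1]%classic = 1%E.
  by rewrite lebesgue_measure_itv/= lte_fin ltr01 sube0.
have -> : (\int[mu2]_x (h x * (u x ^+ 2)%:E) =
    \int[mu]_(s in `]0%R, 1%R]) \int[mu2]_x (h x * (u x ^+ 2)%:E))%E.
  rewrite integral_cst// [X in (_ * X)%E](_ : _ = 1%E) ?mule1//; exact: muI.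
apply: (@le_trans _ _ (\int[mu]_(s in `]0%R, 1%R]) (A s + B))%E).
  apply: ge0_le_integral => //.
  - by move=> s _; exact: integral_ge0.
  - exact: measurable_funTS mAB.
rewrite ge0_integralD//; last exact: measurable_funTS.
have -> : (\int[mu]_(s in `]0%R, 1%R]) B = B)%E.
  rewrite integral_cst// [X in (_ * X)%E](_ : _ = 1%E) ?mule1//; exact: muI.
(* Enlarging ]0, 1] to the whole line turns the average of [A], after Tonelli, into the
   [line_nsq e u] part of the energy. *)
apply: (@le_trans _ _ (\int[mu]_s A s + B)%E).
  by rewrite leeD2r//; apply: ge0_subset_integral.
rewrite -(tonelli3 mK K0) /B -ge0_integralD//; last 2 first.
- by move=> x _; exact: integral_ge0.
- exact: (@measurable_fun_fubini_tonelli_F _ _ R2 R1 R mu K mK K0).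
rewrite le_eqVlt; apply/orP; left; apply/eqP; apply: eq_integral => x _.
suff -> : (\int[mu]_s K (x, s) = h x * (2%:E * line_nsq e u x))%E.
  by apply/esym/ge0_muleDr; apply: mule_ge0 => //; exact: line_nsq_ge0.
have m2 : measurable_fun (setT : set R1) (fun s => (u (x + s *: e)%R ^+ 2)%:E).
  by apply/measurable_EFinP/measurable_funX; exact: measurable_line1.
rewrite /K /= ge0_integralZl//.
- rewrite ge0_integralZl//.
  by move=> s _; rewrite lee_fin sqr_ge0.
- exact: (emeasurable_funM (@measurable_cst _ _ _ _ _ 2%:E) m2).
- by move=> s _; rewrite mule_ge0// lee_fin sqr_ge0.
Qed.

End sobolev.

(** * From lines to the plane: Ladyzhenskaya's argument *)

Section ladyzhenskaya.
Variable R : realType.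
Notation mu := (@lebesgue_measure R).
Notation mu2 := (@lebesgue_measure R \x @lebesgue_measure R)%E.
Notation R1 := (measurableTypeR R).
Notation R2 := (measurableTypeR R * measurableTypeR R)%type.
Implicit Types (f u v : R * R -> R).

Lemma measurable_sqr_EFin f : measurable_fun setT f ->
  measurable_fun (setT : set R2) (fun x => (f x ^+ 2)%:E).
Proof. by move=> mf; apply/measurable_EFinP; exact: measurable_funX. Qed.

(** Shifting the parameter by x shows that the value depends on the ordinate only. *)
Lemma line_nsq_dir1 f (x y : R) : measurable_fun setT f ->
  line_nsq (1, 0)%R f (x, y) = (\int[mu]_s (f ((s : R), y) ^+ 2)%:E)%E.
Proof.
move=> mf.
have m1 : measurable_fun (setT : set R1) (fun s => (f (s, y) ^+ 2)%:E).
  by move/measurable_fun_pair1 : (measurable_sqr_EFin mf) => /(_ y).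
rewrite -(ge0_integral_translate1 x m1) => [|s]; last by rewrite lee_fin sqr_ge0.
apply: eq_integral => s _; congr (f _ ^+ 2)%:E.
by apply: injective_projections; rewrite /= ?scaler0 ?addr0// -[s *: 1]/(s * 1) mulr1 addrC.
Qed.

Lemma line_nsq_dir2 f (x y : R) : measurable_fun setT f ->
  line_nsq (0, 1)%R f (x, y) = (\int[mu]_s (f (x, (s : R)) ^+ 2)%:E)%E.
Proof.
move=> mf.
have m1 : measurable_fun (setT : set R1) (fun s => (f (x, s) ^+ 2)%:E).
  by move/measurable_fun_pair2 : (measurable_sqr_EFin mf) => /(_ x).
rewrite -(ge0_integral_translate1 y m1) => [|s]; last by rewrite lee_fin sqr_ge0.
apply: eq_integral => s _; congr (f _ ^+ 2)%:E.
by apply: injective_projections; rewrite /= ?scaler0 ?addr0// -[s *: 1]/(s * 1) mulr1 addrC.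
Qed.

Lemma int_line_nsq_dir1 f (x : R) : sqint f ->
  (\int[mu]_y line_nsq (1, 0)%R f (x, (y : R)) = (nsq f)%:E)%E.
Proof.
move=> sf; have [mf _] := sf; rewrite EFin_nsq//.
have K0 (z : R2) : (0 <= (f z ^+ 2)%:E)%E by rewrite lee_fin sqr_ge0.
rewrite (@fubini_tonelli2 _ _ R1 R1 R mu mu _ (measurable_sqr_EFin mf) K0).
by apply: eq_integral => y _; rewrite line_nsq_dir1.
Qed.

Lemma int_line_nsq_dir2 f (y : R) : sqint f ->
  (\int[mu]_x line_nsq (0, 1)%R f ((x : R), y) = (nsq f)%:E)%E.
Proof.
move=> sf; have [mf _] := sf; rewrite EFin_nsq//.
have K0 (z : R2) : (0 <= (f z ^+ 2)%:E)%E by rewrite lee_fin sqr_ge0.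
rewrite (@fubini_tonelli1 _ _ R1 R1 R mu mu _ (measurable_sqr_EFin mf) K0).
by apply: eq_integral => x _; rewrite line_nsq_dir2.
Qed.

Lemma ge0_int_lin (p q : R1 -> \bar R) : measurable_fun setT p -> measurable_fun setT q ->
  (forall x, 0 <= p x)%E -> (forall x, 0 <= q x)%E ->
  (\int[mu]_x (2%:E * p x + 2%:E * q x) = 2%:E * \int[mu]_x p x + 2%:E * \int[mu]_x q x)%E.
Proof.
move=> mp mq p0 q0.
have t0 : (0%R <= 2%:E :> \bar R)%E by rewrite lee_fin.
have m2 (k : R1 -> \bar R) : measurable_fun setT k ->
    measurable_fun (setT : set R1) (fun x => 2%:E * k x)%E.
  by move=> mk; exact: (emeasurable_funM (@measurable_cst _ _ _ _ _ 2%:E) mk).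
rewrite ge0_integralD//; last 4 first.
- by move=> x _; exact: mule_ge0.
- exact: m2.
- by move=> x _; exact: mule_ge0.
- exact: m2.
by rewrite !ge0_integralZl.
Qed.

(** Write u^4 = u^2 u^2 and replace one factor by the horizontal line energy, with weight u^2, then
    the other by the vertical one, with the horizontal energy as weight. The first depends on y only
    and the second on x only, so the integral of their product splits. *)
Lemma int_pow4_le u v1 v2 : sqint u -> sqint v1 -> sqint v2 ->
  (forall t : R, 0 < t ->
    {ae mu2, forall x, u (x + t *: (1, 0)) - u x = line_int t (1, 0) v1 x}) ->
  (forall t : R, 0 < t ->
    {ae mu2, forall x, u (x + t *: (0, 1)) - u x = line_int t (0, 1) v2 x}) ->
  (\int[mu2]_x (u x ^+ 4)%:E <=
    ((2 * nsq u + 2 * nsq v1) * (2 * nsq u + 2 * nsq v2))%:E)%E.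
Proof.
move=> su sv1 sv2 inc1 inc2.
have [mu_ _] := su; have [m1 _] := sv1; have [m2 _] := sv2.
pose Q1 := line_energy ((1, 0) : R * R) u v1; pose Q2 := line_energy ((0, 1) : R * R) u v2.
have mQ1 : measurable_fun (setT : set R2) Q1 by exact: measurable_line_energy.
have mQ2 : measurable_fun (setT : set R2) Q2 by exact: measurable_line_energy.
have Q10 x : (0 <= Q1 x)%E by exact: line_energy_ge0.
have Q20 x : (0 <= Q2 x)%E by exact: line_energy_ge0.
have s1 := int_sqr_le_line_energy su sv1 inc1 (measurable_sqr_EFin mu_)
  (fun x => sqr_ge0 (u x)).
have s2 := int_sqr_le_line_energy su sv2 inc2 mQ1 Q10.
have -> : (\int[mu2]_x (u x ^+ 4)%:E = \int[mu2]_x ((u x ^+ 2)%:E * (u x ^+ 2)%:E))%E.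
  by apply: eq_integral => x _; rewrite -EFinM; congr EFin; ring.
apply: (le_trans s1).
have -> : (\int[mu2]_x ((u x ^+ 2)%:E * line_energy (1, 0)%R u v1 x) =
    \int[mu2]_x (Q1 x * (u x ^+ 2)%:E))%E.
  by apply: eq_integral => x _; rewrite muleC.
apply: (le_trans s2).
have sec1 (k : R2 -> \bar R) (y : R) : measurable_fun setT k ->
    measurable_fun (setT : set R1) (fun x => k (x, y)).
  by move/measurable_fun_pair1 => /(_ y).
have sec2 (k : R2 -> \bar R) (x : R) : measurable_fun setT k ->
    measurable_fun (setT : set R1) (fun y => k (x, y)).
  by move/measurable_fun_pair2 => /(_ x).
have mN e f : measurable_fun setT f -> measurable_fun (setT : set R2) (line_nsq e f).
  exact: measurable_line_nsq.
have N0 e f x : (0 <= line_nsq e f x)%E by exact: line_nsq_ge0.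
have I1 (x : R) : (\int[mu]_y Q1 (x, (y : R)) = (2 * nsq u + 2 * nsq v1)%:E)%E.
  rewrite /Q1 /line_energy (@ge0_int_lin (fun y => line_nsq (1, 0)%R u (x, y))
    (fun y => line_nsq (1, 0)%R v1 (x, y)) (sec2 _ x (mN _ _ mu_)) (sec2 _ x (mN _ _ m1))
    (fun y => N0 _ _ _) (fun y => N0 _ _ _)).
  by rewrite !int_line_nsq_dir1.
have I2 (y : R) : (\int[mu]_x Q2 ((x : R), y) = (2 * nsq u + 2 * nsq v2)%:E)%E.
  rewrite /Q2 /line_energy (@ge0_int_lin (fun x => line_nsq (0, 1)%R u (x, y))
    (fun x => line_nsq (0, 1)%R v2 (x, y)) (sec1 _ y (mN _ _ mu_)) (sec1 _ y (mN _ _ m2))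
    (fun y => N0 _ _ _) (fun y => N0 _ _ _)).
  by rewrite !int_line_nsq_dir2.
have Q12 (x y : R) : Q2 (x, y) = Q2 (x, 0).
  by rewrite /Q2 /line_energy !line_nsq_dir2.
have mQ12 := emeasurable_funM mQ1 mQ2.
have Q120 z : (0 <= Q1 z * Q2 z)%E by exact: mule_ge0.
rewrite (@fubini_tonelli1 _ _ R1 R1 R mu mu _ mQ12 Q120).
rewrite (eq_integral (fun x : R1 => (2 * nsq u + 2 * nsq v1)%:E * Q2 (x, 0)%R)%E);
    last first.
  move=> x _; rewrite /fubini_F.
  rewrite (eq_integral (fun y : R1 => Q2 (x, 0)%R * Q1 (x, y))%E); last first.
    by move=> y _; rewrite /= Q12 muleC.
  rewrite (ge0_integralZl _ measurableT (sec2 _ x mQ1) (fun y _ => Q10 _) (Q20 _)).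
  by rewrite I1 muleC.
rewrite (ge0_integralZl _ measurableT (sec1 _ 0 mQ2) (fun y _ => Q20 _)); last first.
  by rewrite lee_fin addr_ge0// mulr_ge0// nsq_ge0.
by rewrite I2 -EFinM.
Qed.

End ladyzhenskaya.

(** * The energy *)

Lemma half_add_lty (R : realType) (a b : \bar R) : (0 <= a)%E -> (0 <= b)%E ->
  ((2^-1)%:E * a + b < +oo)%E -> (a < +oo)%E /\ (b < +oo)%E.
Proof.
move=> a0 b0 ab; split; rewrite ltNge leye_eq; apply: contraTN ab => /eqP ->.
  by rewrite mulry gtr0_sg ?invr_gt0// mul1e addye ?ltxx// gt_eqF// (lt_le_trans _ b0)// ltNy0.
have h0 : (0 <= (2^-1)%:E * a)%E by rewrite mule_ge0// lee_fin invr_ge0.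
by rewrite addey ?ltxx// gt_eqF// (lt_le_trans _ h0)// ltNy0.
Qed.

(** Here a, b, c stand for the squared norms of m_i and of its two derivatives. Each product is at
    most 4 (a + b + c)^2, so 4 S is at most 12 times the square of the total sum; as D + Z is half
    that sum, the factor 3 for S becomes 12. *)
Lemma sum_mul_le_sqr (R : realFieldType) (S a1 a2 a3 b1 b2 b3 c1 c2 c3 : R) :
  0 <= a1 -> 0 <= a2 -> 0 <= a3 -> 0 <= b1 -> 0 <= b2 -> 0 <= b3 ->
  0 <= c1 -> 0 <= c2 -> 0 <= c3 ->
  4 * S <= 3 * ((2 * a1 + 2 * b1) * (2 * a1 + 2 * c1) +
    (2 * a2 + 2 * b2) * (2 * a2 + 2 * c2) + (2 * a3 + 2 * b3) * (2 * a3 + 2 * c3)) ->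
  S <= 12 * (2^-1 * (b1 + b2 + b3 + (c1 + c2 + c3)) + 2^-1 * (a1 + a2 + a3)) ^+ 2.
Proof.
move=> a10 a20 a30 b10 b20 b30 c10 c20 c30 H4.
have q (a b c : R) : 0 <= a -> 0 <= b -> 0 <= c ->
    (2 * a + 2 * b) * (2 * a + 2 * c) <= 4 * (a + b + c) ^+ 2 by move=> *; nra.
have := q _ _ _ a10 b10 c10; have := q _ _ _ a20 b20 c20; have := q _ _ _ a30 b30 c30.
have s1 : 0 <= a1 + b1 + c1 by rewrite !addr_ge0.
have s2 : 0 <= a2 + b2 + c2 by rewrite !addr_ge0.
have s3 : 0 <= a3 + b3 + c3 by rewrite !addr_ge0.
have := mulr_ge0 s1 s2; have := mulr_ge0 s2 s3; have := mulr_ge0 s1 s3.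
have -> : 2^-1 * (b1 + b2 + b3 + (c1 + c2 + c3)) + 2^-1 * (a1 + a2 + a3) =
    2^-1 * ((a1 + b1 + c1) + (a2 + b2 + c2) + (a3 + b3 + c3)) by ring.
move: H4; move: ((2 * a1 + 2 * b1) * _) ((2 * a2 + 2 * b2) * _) ((2 * a3 + 2 * b3) * _).
move: (a1 + b1 + c1) (a2 + b2 + c2) (a3 + b3 + c3) => x y z p1 p2 p3 *.
have -> : 12 * (2^-1 * (x + y + z)) ^+ 2 =
    3 * (x ^+ 2 + y ^+ 2 + z ^+ 2) + 6 * (x * y + y * z + x * z) by field.
lra.
Qed.

Section energy.
Variable R : realType.
Notation mu2 := (@lebesgue_measure R \x @lebesgue_measure R)%E.
Notation R2 := (measurableTypeR R * measurableTypeR R)%type.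

Lemma Eenergy_e3 (r h : R) : Eenergy r h (@e3 R) (fun _ _ _ => 0) = 0%E.
Proof.
have z (f : R * R -> R) : (forall x, f x = 0) -> (\int[@leb2 R]_x (f x)%:E = 0)%E.
  by move=> f0; apply: integral0_eq => x _; rewrite f0.
rewrite /Eenergy /Denergy /Henergy /Venergy /Zenergy !z ?mule0 ?adde0//.
- by move=> x; rewrite /e3 /= subrr.
- by move=> x; rewrite /dist2_e3 /e3 /=; ring.
- by move=> x; rewrite /e3 /=; ring.
- by move=> x; rewrite big1// => j _; rewrite big1// => i _; rewrite expr0n.
Qed.

Variables (n : 'I_3 -> R * R -> R) (dn : 'I_2 -> 'I_3 -> R * R -> R).
Hypothesis Mn : in_Mprime n dn.

Let m (i : 'I_3) (x : R * R) : R := n i x - e3 i x.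

Lemma dist2_e3E x : dist2_e3 n x = m i1 x ^+ 2 + m i2 x ^+ 2 + m i3 x ^+ 2.
Proof. by rewrite /dist2_e3 /m /e3 /= !subr0. Qed.

Lemma dist2_e3_sphere x : dist2_e3 n x = 2 * (1 - n i3 x).
Proof.
have [/(_ x) sp _] := Mn.
transitivity ((n i1 x ^+ 2 + n i2 x ^+ 2 + n i3 x ^+ 2) - 2 * n i3 x + 1).
  by rewrite /dist2_e3; ring.
by rewrite sp; ring.
Qed.

Lemma sum_I3 (F : 'I_3 -> R) : \sum_(i < 3) F i = F i1 + F i2 + F i3.
Proof.
rewrite !big_ord_recr big_ord0 /= add0r.
by congr (F _ + F _ + F _); exact: val_inj.
Qed.

Lemma sum_I2 (F : 'I_2 -> R) : \sum_(j < 2) F j = F j1 + F j2.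
Proof.
rewrite !big_ord_recr big_ord0 /= add0r.
by congr (F _ + F _); exact: val_inj.
Qed.

Lemma measurable_n i : measurable_fun setT (n i).
Proof. by have [_ [/(_ j1 i)[[]]]] := Mn. Qed.

Lemma measurable_dn j i : measurable_fun setT (dn j i).
Proof. by have [_ [/(_ j i)[_ [[]]]]] := Mn. Qed.

Lemma measurable_m i : measurable_fun setT (m i).
Proof.
by apply: measurable_funB; [exact: measurable_n|exact: measurable_cst].
Qed.

Let grad2 (x : R * R) : R := \sum_(j < 2) \sum_(i < 3) dn j i x ^+ 2.

Let grad2_ge0 x : 0 <= grad2 x.
Proof. by apply: sumr_ge0 => j _; apply: sumr_ge0 => i _; exact: sqr_ge0. Qed.

Let measurable_grad2 : measurable_fun (setT : set R2) grad2.
Proof.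
have md j i : measurable_fun (setT : set R2) (fun x => dn j i x ^+ 2).
  by apply: measurable_funX; exact: measurable_dn.
have -> : grad2 = fun x => (dn j1 i1 x ^+ 2 + dn j1 i2 x ^+ 2 + dn j1 i3 x ^+ 2) +
    (dn j2 i1 x ^+ 2 + dn j2 i2 x ^+ 2 + dn j2 i3 x ^+ 2).
  by apply/funext => x; rewrite /grad2 sum_I2 !sum_I3.
by do ![apply: measurable_funD => //].
Qed.

Let Z_ge0 x : 0 <= 1 - n i3 x.
Proof.
have := dist2_e3_sphere x; rewrite dist2_e3E.
by have := sqr_ge0 (m i1 x); have := sqr_ge0 (m i2 x); have := sqr_ge0 (m i3 x); lra.
Qed.

Let finite_energies : (\int[mu2]_x (grad2 x)%:E < +oo)%E /\ (Zenergy n < +oo)%E.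
Proof.
have [_ [_ fin]] := Mn; apply: half_add_lty fin.
  by apply: integral_ge0 => x _; rewrite lee_fin; exact: grad2_ge0.
by apply: integral_ge0 => x _; rewrite lee_fin; exact: Z_ge0.
Qed.

Lemma integrable_grad2 : mu2.-integrable setT (EFin \o grad2).
Proof.
apply/integrableP; split; first exact/measurable_EFinP.
apply: le_lt_trans finite_energies.1; rewrite le_eqVlt; apply/orP; left; apply/eqP.
by apply: eq_integral => x _; rewrite /= ger0_norm.
Qed.

Lemma integrable_Z : mu2.-integrable setT (EFin \o (fun x => 1 - n i3 x)).
Proof.
have mz : measurable_fun (setT : set R2) (fun x => 1 - n i3 x).
  by apply: measurable_funB; [exact: measurable_cst|exact: measurable_n].
apply/integrableP; split; first exact/measurable_EFinP.
apply: le_lt_trans finite_energies.2; rewrite le_eqVlt; apply/orP; left; apply/eqP.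
by apply: eq_integral => x _; rewrite /= ger0_norm.
Qed.

Lemma I3P (P : 'I_3 -> Prop) : P i1 -> P i2 -> P i3 -> forall i, P i.
Proof.
move=> p1 p2 p3 [[|[|[|//]]] Hi].
- by rewrite (_ : Ordinal Hi = i1)//; exact: val_inj.
- by rewrite (_ : Ordinal Hi = i2)//; exact: val_inj.
- by rewrite (_ : Ordinal Hi = i3)//; exact: val_inj.
Qed.

Lemma sqint_m i : sqint (m i).
Proof.
split; first exact: measurable_m.
apply: (le_integrable measurableT _ _ (integrableZl measurableT 2 integrable_Z)).
  by apply/measurable_EFinP/measurable_funX; exact: measurable_m.
move=> x _; rewrite /= lee_fin ger0_norm ?sqr_ge0// ger0_norm ?mulr_ge0//.
rewrite -dist2_e3_sphere dist2_e3E.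
have := sqr_ge0 (m i1 x); have := sqr_ge0 (m i2 x); have := sqr_ge0 (m i3 x).
by move: i; apply: I3P; lra.
Qed.

Lemma sqint_dn j i : sqint (dn j i).
Proof.
split; first exact: measurable_dn.
apply: (le_integrable measurableT _ _ integrable_grad2).
  by apply/measurable_EFinP/measurable_funX; exact: measurable_dn.
move=> x _; rewrite /= lee_fin ger0_norm ?sqr_ge0// ger0_norm//.
rewrite /grad2 (bigD1 j)//= (bigD1 i)//= -addrA lerDl addr_ge0//.
  by apply: sumr_ge0 => k _; exact: sqr_ge0.
by apply: sumr_ge0 => k _; apply: sumr_ge0 => l _; exact: sqr_ge0.
Qed.

Lemma m_increment j i (t : R) : 0 < t ->
  {ae mu2, forall x, m i (x + t *: dir R j) - m i x = line_int t (dir R j) (dn j i) x}.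
Proof.
(* The constant restores n from m; e3 may be evaluated anywhere, in particular at the origin. *)
move=> t0; apply: (@weak_partial_increment R j (m i) (dn j i) (e3 i 0)) => //.
- have [_ [wg _]] := Mn; rewrite (_ : (fun x => _) = n i)//.
  by apply/funext => x; rewrite /m /e3 subrK.
- exact: sqint_m.
- exact: sqint_dn.
Qed.

Lemma Denergy_nsq : Denergy n dn = (2^-1 * \sum_(j < 2) \sum_(i < 3) nsq (dn j i))%:E.
Proof.
have ig j i : mu2.-integrable setT (fun x => (dn j i x ^+ 2)%:E) by have [] := sqint_dn j i.
rewrite /Denergy EFinM; congr (_ * _)%E.
transitivity (\int[mu2]_x (\sum_(j < 2) (\sum_(i < 3) (dn j i x ^+ 2)%:E)))%E.
  by apply: eq_integral => x _; rewrite -sumEFin; apply: eq_bigr => j _; rewrite -sumEFin.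
rewrite integral_sum//; last by move=> j; exact: integrable_sum.
rewrite -sumEFin; apply: eq_bigr => j _.
rewrite integral_sum// -sumEFin; apply: eq_bigr => i _.
by rewrite EFin_nsq//; exact: sqint_dn.
Qed.

Lemma Zenergy_nsq : Zenergy n = (2^-1 * (nsq (m i1) + nsq (m i2) + nsq (m i3)))%:E.
Proof.
have ig i : mu2.-integrable setT (EFin \o (fun x => m i x ^+ 2)) by have [] := sqint_m i.
have i12 := integrableD measurableT (ig i1) (ig i2).
rewrite /nsq -RintegralD// -RintegralD// -RintegralZl//; last first.
  exact: (integrableD measurableT i12 (ig i3)).
rewrite (_ : Rintegral _ _ _ = \int[mu2]_x (1 - n i3 x)); last first.
  by apply: eq_Rintegral => x _; rewrite -dist2_e3E dist2_e3_sphere mulKf.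
by rewrite /Rintegral fineK//; exact: (integrable_fin_num measurableT integrable_Z).
Qed.

(** Consequently |m|^4 = 4 m3^2: the fourth power of the L^4 distance is four times a squared L^2
    norm, and W becomes [4 * nsq (m i3)]. *)
Lemma dist2_e3_m3 x : dist2_e3 n x = - 2 * m i3 x.
Proof. by rewrite dist2_e3_sphere /m /e3 /=; ring. Qed.

Lemma int_dist2_e3 : (\int[mu2]_x (dist2_e3 n x ^+ 2)%:E = (4 * nsq (m i3))%:E)%E.
Proof.
have [_ im] := sqint_m i3.
rewrite EFinM EFin_nsq//; last exact: sqint_m.
rewrite -integralZl//; apply: eq_integral => x _.
by rewrite dist2_e3_m3 -EFinM; congr EFin; ring.
Qed.

Lemma Venergy_nsq : Venergy n = (2^-1 * nsq (m i3))%:E.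
Proof.
rewrite /Venergy [X in (_ * X)%E](_ : _ = (4 * nsq (m i3))%:E); last exact: int_dist2_e3.
by rewrite -EFinM; congr EFin; field.
Qed.

Lemma Henergy_bound (r : R) : 0 < r -> exists2 H : R, Henergy n dn = H%:E &
  `|r * H| <= 2^-1 * (2^-1 * \sum_(j < 2) \sum_(i < 3) nsq (dn j i))
    + 8 * r ^+ 2 * nsq (m i3).
Proof.
move=> r0.
have bp j i k : \int[mu2]_x (m i x * dn j k x) = - \int[mu2]_x (m k x * dn j i x).
  apply: (@Rintegral_by_parts R (dir R j)).
  - exact: sqint_m.
  - exact: sqint_dn.
  - exact: sqint_m.
  - exact: sqint_dn.
  - by move=> t; exact: m_increment.
  - by move=> t; exact: m_increment.
have im j i k : mu2.-integrable setT (EFin \o (fun x => m i x * dn j k x)).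
  by apply: sqintM; [exact: sqint_m|exact: sqint_dn].
pose A j i k := \int[mu2]_x (m i x * dn j k x).
have iB1 := integrableB measurableT (im j2 i1 i3) (im j1 i2 i3).
have iB2 := integrableB measurableT (im j1 i3 i2) (im j2 i3 i1).
exists (2 * (A j1 i3 i2 - A j2 i3 i1)).
  transitivity (\int[mu2]_x (((m i1 x * dn j2 i3 x - m i2 x * dn j1 i3 x) +
      (m i3 x * dn j1 i2 x - m i3 x * dn j2 i1 x)))%:E)%E.
    by apply: eq_integral => x _; congr EFin; rewrite /m /e3 /=; ring.
  have iD := integrableD measurableT iB1 iB2.
  rewrite -(fineK (integrable_fin_num measurableT iD)); congr EFin.
  rewrite -[LHS]/(\int[mu2]_x ((m i1 x * dn j2 i3 x - m i2 x * dn j1 i3 x) +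
      (m i3 x * dn j1 i2 x - m i3 x * dn j2 i1 x))).
  rewrite RintegralD// !RintegralB// (bp j2 i1 i3) (bp j1 i2 i3) -/(A j1 i3 i2) -/(A j2 i3 i1).
  by ring.
(* The weight 4 r gives the two derivatives that occur the coefficient 2 r / (4 r) / 2 = 1/4, which
   is their coefficient in D/2. Each pairing also contributes 2 r (4 r) / 2 = 4 r^2 times the
   squared norm of m3, hence 8 r^2 in total. *)
have l0 : 0 < 4 * r by rewrite mulr_gt0.
have b1 := norm_int_mul_le l0 (sqint_m i3) (sqint_dn j1 i2).
have b2 := norm_int_mul_le l0 (sqint_m i3) (sqint_dn j2 i1).
rewrite -/(A j1 i3 i2) in b1; rewrite -/(A j2 i3 i1) in b2.
rewrite sum_I2 !sum_I3.
have N0 j i := nsq_ge0 (dn j i).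
move: (N0 j1 i1) (N0 j1 i2) (N0 j1 i3) (N0 j2 i1) (N0 j2 i2) (N0 j2 i3) b1 b2.
move: (A j1 i3 i2) (A j2 i3 i1) (nsq (m i3)) => a b S.
move: (nsq (dn j1 i1)) (nsq (dn j1 i2)) (nsq (dn j1 i3)) (nsq (dn j2 i1)) (nsq (dn j2 i2))
  (nsq (dn j2 i3)) => p1 p2 p3 q1 q2 q3.
move=> hp1 hp2 hp3 hq1 hq2 hq3 ha hb.
have -> : r * (2 * (a - b)) = (2 * r) * (a - b) by ring.
rewrite normrM gtr0_norm ?mulr_gt0//.
apply: (@le_trans _ _ (2 * r * ((4 * r * S + (4 * r)^-1 * p2) / 2 +
    (4 * r * S + (4 * r)^-1 * q1) / 2))).
  by rewrite ler_pM2l ?mulr_gt0// (le_trans (ler_normB _ _))// lerD.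
have -> : 2 * r * ((4 * r * S + (4 * r)^-1 * p2) / 2 + (4 * r * S + (4 * r)^-1 * q1) / 2)
    = 8 * r ^+ 2 * S + (p2 + q1) / 4 by field; rewrite gt_eqF.
rewrite addrC lerD2r; lra.
Qed.

Lemma nsq_m3_le : nsq (m i3) <= 12 *
  (2^-1 * (\sum_(j < 2) \sum_(i < 3) nsq (dn j i)) +
   2^-1 * (nsq (m i1) + nsq (m i2) + nsq (m i3))) ^+ 2.
Proof.
have L i := int_pow4_le (sqint_m i) (sqint_dn j1 i) (sqint_dn j2 i)
  (fun t => @m_increment j1 i t) (fun t => @m_increment j2 i t).
have m4 i : measurable_fun (setT : set R2) (fun x => (m i x ^+ 4)%:E).
  by apply/measurable_EFinP/measurable_funX; exact: measurable_m.
have p4 i x : (0 <= (m i x ^+ 4)%:E)%E by rewrite lee_fin exprn_even_ge0.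
have H : (\int[mu2]_x (dist2_e3 n x ^+ 2)%:E <=
    3%:E * \int[mu2]_x ((m i1 x ^+ 4)%:E + (m i2 x ^+ 4)%:E + (m i3 x ^+ 4)%:E))%E.
  rewrite -ge0_integralZl//.
  - apply: ge0_le_integral => //.
    + by move=> x _; rewrite lee_fin sqr_ge0.
    + apply/measurable_EFinP/measurable_funX.
      have -> : dist2_e3 n = fun x => - 2 * m i3 x by apply/funext => x; exact: dist2_e3_m3.
      by apply: measurable_funM => //; exact: measurable_m.
    + apply: (emeasurable_funM (@measurable_cst _ _ _ _ _ 3%:E)).
      exact: (emeasurable_funD (emeasurable_funD (m4 i1) (m4 i2)) (m4 i3)).
    + move=> x _; rewrite -!EFinD -EFinM lee_fin dist2_e3E.
      (* These three squares sum to 3 (p^2 + q^2 + s^2) - (p + q + s)^2, where p, q, s are the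
         squares of the components of m. *)
      have := sqr_ge0 (m i1 x ^+ 2 - m i2 x ^+ 2).
      have := sqr_ge0 (m i2 x ^+ 2 - m i3 x ^+ 2).
      have := sqr_ge0 (m i3 x ^+ 2 - m i1 x ^+ 2).
      by nra.
  - exact: (emeasurable_funD (emeasurable_funD (m4 i1) (m4 i2)) (m4 i3)).
  - by move=> x _; rewrite !adde_ge0.
rewrite int_dist2_e3 ge0_integralD// in H; last 2 first.
- by move=> x _; rewrite !adde_ge0.
- exact: (emeasurable_funD (m4 i1) (m4 i2)).
rewrite ge0_integralD// in H.
have t3 : (0%R <= 3%:E :> \bar R)%E by rewrite lee_fin.
have := le_trans H (lee_wpmul2l t3 (leeD (leeD (L i1) (L i2)) (L i3))).
rewrite -!EFinD -EFinM lee_fin sum_I2 !sum_I3.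
move=> H4; exact: (sum_mul_le_sqr (nsq_ge0 _) (nsq_ge0 _) (nsq_ge0 _) (nsq_ge0 _)
  (nsq_ge0 _) (nsq_ge0 _) (nsq_ge0 _) (nsq_ge0 _) (nsq_ge0 _) H4).
Qed.

Lemma L4dist_pow4 : ((L4dist_e3 n) `^ 4 = (4 * nsq (m i3))%:E)%E.
Proof.
rewrite /L4dist_e3 poweR_Lnorm// -int_dist2_e3; apply: eq_integral => x _.
have d0 : 0 <= dist2_e3 n x by rewrite dist2_e3E !addr_ge0 ?sqr_ge0.
rewrite /= ger0_norm ?sqrtr_ge0// powR_mulrn ?sqrtr_ge0//.
by rewrite -[4%N]/(2 * 2)%N exprM sqr_sqrtr.
Qed.

(** Reduces the theorem to arithmetic on four real numbers: S is W/4, the term S/2 is V, and half of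
    D has been spent on the helicity. *)
Lemma Eenergy_lower_bound (r h : R) : 0 < r -> exists D Z S E : R,
  [/\ 0 <= D, 0 <= Z, S <= 12 * (D + Z) ^+ 2,
    ((L4dist_e3 n) `^ 4 = (4 * S)%:E)%E & Eenergy r h n dn = E%:E /\
    2^-1 * D + h * Z + 2^-1 * S - 8 * r ^+ 2 * S <= E].
Proof.
move=> r0; have [H HE Hle] := Henergy_bound r0.
exists (2^-1 * \sum_(j < 2) \sum_(i < 3) nsq (dn j i)),
  (2^-1 * (nsq (m i1) + nsq (m i2) + nsq (m i3))), (nsq (m i3)).
eexists; split.
- rewrite mulr_ge0//; apply: sumr_ge0 => j _; apply: sumr_ge0 => i _; exact: nsq_ge0.
- by rewrite mulr_ge0// !addr_ge0// nsq_ge0.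
- exact: nsq_m3_le.
- exact: L4dist_pow4.
split.
  by rewrite /Eenergy HE Denergy_nsq Venergy_nsq Zenergy_nsq -!EFinM -!EFinD; reflexivity.
move: Hle; rewrite ler_norml => /andP[+ _].
move: (2^-1 * \sum_(j < 2) _) (nsq (m i3)) (2^-1 * (_ + _)) => D S Z Hle.
by lra.
Qed.

End energy.

Theorem theorem5p1 (R : realType) (r h : R) (hr : 0 < r) (hh : 0 < h) :
  exists delta : R, 0 < delta /\
    forall (n : 'I_3 -> R * R -> R) (dn : 'I_2 -> 'I_3 -> R * R -> R),
      in_Mprime n dn ->
      (0 < L4dist_e3 n)%E -> (L4dist_e3 n <= delta%:E)%E ->
      (Eenergy r h (@e3 R) (fun _ _ _ => 0%R) < Eenergy r h n dn)%E.
Proof.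
(* A common coefficient: D/2 + h Z is at least k (D + Z). *)
pose k := Num.min 2^-1 h; have k0 : 0 < k by rewrite lt_min hh invr_gt0 ltr0n.
have r20 : 0 < 16 * r ^+ 2 by rewrite mulr_gt0// exprn_gt0.
(* Chosen so that 16 r^2 delta^2 <= k; the cap at 1 gives delta^2 <= delta. *)
pose delta := Num.min 1 (k / (16 * r ^+ 2)).
have d0 : 0 < delta by rewrite lt_min ltr01 divr_gt0.
have dk : 16 * r ^+ 2 * delta ^+ 2 <= k.
  rewrite mulrC -ler_pdivlMr//; apply: (@le_trans _ _ delta).
    by rewrite expr2 ler_piMl// ?(ltW d0)// /delta ge_min lexx.
  by rewrite /delta ge_min lexx orbT.
exists delta; split => // n dn Mn L0 Ld; rewrite Eenergy_e3.
have [D [Z [S [E [D0 Z0 SDZ LS [-> EE]]]]]] := Eenergy_lower_bound Mn h hr.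
rewrite lte_fin; apply: lt_le_trans EE.
move: L0 Ld LS; case: (L4dist_e3 n) => [l| |]//; rewrite lte_fin lee_fin => l0 ld.
rewrite poweR_EFin powR_mulrn ?ltW// => -[lS].
have l40 : 0 < l ^+ 4 by exact: exprn_gt0.
have S0 : 0 < S by lra.
have Sd : 4 * S <= delta ^+ 4.
  by rewrite -lS lerXn2r// nnegrE ltW.
have N0 : 0 <= D + Z by rewrite addr_ge0.
(* One factor of S^2 is bounded by delta^4 / 4 and the other by the Sobolev inequality, which gives
   S^2 <= 3 delta^4 (D + Z)^2; the 2 is a bound for the square root of 3. *)
have SN : S <= 2 * delta ^+ 2 * (D + Z).
  have dN0 : 0 <= 2 * delta ^+ 2 * (D + Z) by rewrite mulr_ge0// mulr_ge0// sqr_ge0.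
  rewrite -ler_sqr ?nnegrE//; last exact: ltW.
  apply: (@le_trans _ _ (delta ^+ 4 / 4 * (12 * (D + Z) ^+ 2))).
    rewrite expr2; apply: ler_pM => //; [exact: ltW|exact: ltW|].
    by rewrite ler_pdivlMr// mulrC.
  rewrite -subr_ge0.
  have -> : (2 * delta ^+ 2 * (D + Z)) ^+ 2 - delta ^+ 4 / 4 * (12 * (D + Z) ^+ 2) =
    (delta ^+ 2 * (D + Z)) ^+ 2 by field.
  exact: sqr_ge0.
have rSN : 8 * r ^+ 2 * S <= k * (D + Z).
  apply: le_trans (ler_wpM2r N0 dk).
  have -> : 16 * r ^+ 2 * delta ^+ 2 * (D + Z) =
    8 * r ^+ 2 * (2 * delta ^+ 2 * (D + Z)) by ring.
  by rewrite ler_wpM2l// mulr_ge0// sqr_ge0.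
have kD : k * D <= 2^-1 * D by rewrite ler_wpM2r// /k ge_min lexx.
have kZ : k * Z <= h * Z by rewrite ler_wpM2r// /k ge_min lexx orbT.
(* After absorption the lower bound for E is at least S/2, which is positive. *)
by rewrite mulrDr in rSN; lra.
Qed.
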